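(* Let $\rho^{ab}$ be a state on $\mathcal H_a\otimes\mathcal H_b$ and fix an orthonormal basis $\{|i\rangle\}_{i=1}^{n_a}$ of $\mathcal H_a$. Let $\eta_i=\mathrm{Tr}\big[(|i\rangle\langle i|\otimes I^b)\rho^{ab}\big]$ and, for $\eta_i>0$, $\omega_i=\eta_i^{-1}\sqrt{\rho^{ab}}\,(|i\rangle\langle i|\otimes I^b)\sqrt{\rho^{ab}}$. Then $$C^a_F(\rho^{ab})=P^{opt(vN)}_E(\{\omega_i,\eta_i\}),$$ and consequently $C^a_F(\rho^{ab})\ge P^{opt}_E(\{\omega_i,\eta_i\})$. Moreover, if the states $\{\omega_i:\eta_i>0\}$ are linearly independent, then $C^a_F(\rho^{ab})=P^{opt}_E(\{\omega_i,\eta_i\})$.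
   Context: $\mathcal H_a,\mathcal H_b$ are finite-dimensional with $\dim\mathcal H_a=n_a$. The set of partial incoherent states (with respect to the Lüders measurement $\{|i\rangle\langle i|\otimes I^b\}$) is $I^a_P=\{\sigma:\sum_i(|i\rangle\langle i|\otimes I^b)\sigma(|i\rangle\langle i|\otimes I^b)=\sigma\}$, i.e. the states of the form $\sum_ip_i|i\rangle\langle i|\otimes\sigma_i$. The fidelity partial coherence is $C^a_F(\rho^{ab})=\min_{\sigma\in I^a_P}\big(1-F^2(\rho^{ab},\sigma)\big)$ with $F(\rho,\sigma)=\mathrm{Tr}\sqrt{\sqrt\sigma\rho\sqrt\sigma}$. For an ensemble $\{\rho_i,\eta_i\}$ (states $\rho_i$ with prior probabilities $\eta_i$), $P^{opt}_S=\max_{\{M_i\}}\sum_i\eta_i\mathrm{Tr}(M_i\rho_i)$ over all POVMs $\{M_i\}$, $P^{opt}_E=1-P^{opt}_S$, and $P^{opt(vN)}_E$ is defined in the same way but with the maximization restricted to von Neumann measurements, i.e. families of mutually orthogonal projectors $\{\pi_i\}$ (one per index, possibly zero) summing to the identity. States $\{\rho_i\}$ with spectral decompositions $\rho_i=\sum_j\lambda_{ij}|\psi_{ij}\rangle\langle\psi_{ij}|$ ($\lambda_{ij}>0$) are called linearly independent if the whole collection of vectors $\{|\psi_{ij}\rangle\}_{i,j}$ is linearly independent. *)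

(* Defs.v *)
(* Quantum states on H_a (x) H_b, dim H_a = na, dim H_b = nb,
   represented as (na*nb) x (na*nb) matrices over a numeric closed field C
   (e.g. the complex numbers); the basis of H_a (x) H_b is ordered by
   mathcomp's [mxvec_index i j] (i : 'I_na, j : 'I_nb). *)
From HB Require Import structures.
From mathcomp Require Import all_boot all_order all_algebra.
From Stdlib Require Import ClassicalEpsilon.
Set Implicit Arguments.
Unset Strict Implicit.
Unset Printing Implicit Defensive.
Import Order.TTheory GRing.Theory Num.Theory.
Local Open Scope ring_scope.
Local Open Scope sesquilinear_scope.

Section Quantum.
Variable C : numClosedFieldType.

Definition adj m n (A : 'M[C]_(m, n)) : 'M[C]_(n, m) := A ^t*.

Definition hermitian n (A : 'M[C]_n) : Prop := adj A = A.

Definition psd n (A : 'M[C]_n) : Prop :=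
  hermitian A /\ forall v : 'cV[C]_n, 0 <= (adj v *m A *m v) 0 0.

Definition is_state n (A : 'M[C]_n) : Prop := psd A /\ \tr A = 1.

Definition sqrtm n (A : 'M[C]_n) : 'M[C]_n :=
  epsilon (inhabits 0) (fun B => psd B /\ B *m B = A).

Definition fidelity n (rho sigma : 'M[C]_n) : C :=
  \tr (sqrtm (sqrtm sigma *m rho *m sqrtm sigma)).

Variables na nb : nat.
Local Notation N := (na * nb)%N.

(* |i><i| (x) I^b *)
Definition projA (i : 'I_na) : 'M[C]_N :=
  \sum_(j < nb) delta_mx (mxvec_index i j) (mxvec_index i j).

Definition partial_incoherent (sigma : 'M[C]_N) : Prop :=
  is_state sigma /\ \sum_(i < na) projA i *m sigma *m projA i = sigma.

Definition CF_values (rho : 'M[C]_N) (x : C) : Prop :=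
  exists sigma, partial_incoherent sigma /\ x = 1 - fidelity rho sigma ^+ 2.

Definition is_min (P : C -> Prop) (c : C) : Prop :=
  P c /\ forall x, P x -> c <= x.
Definition is_max (P : C -> Prop) (c : C) : Prop :=
  P c /\ forall x, P x -> x <= c.

Definition ens_eta (rho : 'M[C]_N) (i : 'I_na) : C := \tr (projA i *m rho).

(* omega_i = eta_i^-1 sqrt rho (|i><i| (x) I^b) sqrt rho  (for eta_i > 0;
   set to 0 when eta_i = 0, where it only appears multiplied by eta_i) *)
Definition ens_omega (rho : 'M[C]_N) (i : 'I_na) : 'M[C]_N :=
  if ens_eta rho i == 0 then 0
  else (ens_eta rho i)^-1 *: (sqrtm rho *m projA i *m sqrtm rho).

Definition is_POVM (M : 'I_na -> 'M[C]_N) : Prop :=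
  (forall i, psd (M i)) /\ \sum_(i < na) M i = 1%:M.

Definition is_vN (P : 'I_na -> 'M[C]_N) : Prop :=
  (forall i, hermitian (P i)) /\ (forall i, P i *m P i = P i) /\
  (forall i j, i != j -> P i *m P j = 0) /\ \sum_(i < na) P i = 1%:M.

Definition success (et : 'I_na -> C) (rh : 'I_na -> 'M[C]_N)
  (M : 'I_na -> 'M[C]_N) : C := \sum_(i < na) et i * \tr (M i *m rh i).

Definition POVM_success (et : 'I_na -> C) (rh : 'I_na -> 'M[C]_N) (x : C) :=
  exists M, is_POVM M /\ x = success et rh M.
Definition vN_success (et : 'I_na -> C) (rh : 'I_na -> 'M[C]_N) (x : C) :=
  exists P, is_vN P /\ x = success et rh P.

(* The states {rh_i : et_i > 0} are linearly independent: for spectral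
   decompositions rh_i = sum_j lam_ij |psi_ij><psi_ij| (lam_ij > 0, psi_ij
   orthonormal for each i), the whole family {psi_ij}_{i,j} is linearly
   independent. (Independent of the chosen decompositions.) *)
Definition lin_indep_states (et : 'I_na -> C) (rh : 'I_na -> 'M[C]_N) : Prop :=
  exists (r : 'I_na -> nat) (lam : forall i, 'I_(r i) -> C)
         (psi : forall i, 'I_(r i) -> 'cV[C]_N),
    (forall i, ~ (0 < et i) -> r i = 0%N) /\
    (forall i j, 0 < lam i j) /\
    (forall i j k, (adj (psi i j) *m psi i k) 0 0 = (j == k)%:R) /\
    (forall i, 0 < et i ->
       rh i = \sum_(j < r i) lam i j *: (psi i j *m adj (psi i j))) /\
    (forall c : forall i, 'I_(r i) -> C,
       \sum_(i < na) \sum_(j < r i) c i j *: psi i j = 0 ->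
       forall i j, c i j = 0).

End Quantum.

Arguments projA {C na nb} i.
Arguments partial_incoherent {C na nb} sigma.
Arguments CF_values {C na nb} rho x.
Arguments ens_eta {C na nb} rho i.
Arguments ens_omega {C na nb} rho i.
Arguments is_POVM {C na nb} M.
Arguments is_vN {C na nb} P.
Arguments success {C na nb} et rh M.
Arguments POVM_success {C na nb} et rh x.
Arguments vN_success {C na nb} et rh x.
Arguments lin_indep_states {C na nb} et rh.

(* Main.v *)
(* Write s for the square root of rho and Pi_i = |i><i| (x) I. With
   X_i = eta_i omega_i = s Pi_i s, the success probability of {M_i} is
   sum_i tr(M_i X_i).

   Fidelity against von Neumann measurements. If sigma is incoherent, its root
   commutes with every Pi_i; polar decomposition writes F(rho, sigma) as
   tr(U s sqrt(sigma)) with U unitary, and Cauchy-Schwarz bounds its square by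
   the success probability of {U^* Pi_i U}. Conversely a von Neumann
   measurement {P_i} yields B = sum_i P_i s Pi_i, whose Gram matrix B^* B is
   block diagonal with trace the success probability w of {P_i}; then
   sigma = B^* B / w satisfies F(rho, sigma)^2 >= w.

   Existence of the optima. C is an arbitrary algebraically closed field with
   conjugation, so compactness is not available. Its real subfield is real
   closed; by quantifier elimination its definable bounded subsets have suprema,
   hence projections of closed bounded definable sets are closed, and polynomial
   functions attain their maxima on closed bounded algebraic sets, in
   particular on the set of isometries.

   Linearly independent states. An optimal POVM has K = sum_i M_i X_i hermitian,
   K >= X_i and M_i K = M_i X_i; compressed to the support of rho, independence
   then forces the operators M_i to be mutually orthogonal projectors. *)
Require Import Defs.
From HB Require Import structures.
From mathcomp Require Import all_boot all_order all_algebra.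
From mathcomp Require Import ring polyrcf ordered_qelim qe_rcf.
From Stdlib Require Import Classical ClassicalEpsilon FunctionalExtensionality.
Set Implicit Arguments.
Unset Strict Implicit.
Unset Printing Implicit Defensive.
Import Order.TTheory GRing.Theory Num.Theory.
Local Open Scope ring_scope.

(** * The real subfield *)

Section RealSubfield.
Variable C : numClosedFieldType.

(** The real elements of [C] form a type of their own, so that quantifier elimination over real
    closed fields can be applied to it. *)
Record realsub := RealSub { rsval : C; rsvalP : rsval \is Num.real }.
HB.instance Definition _ := [isSub for rsval].
HB.instance Definition _ := [Choice of realsub by <:].
HB.instance Definition _ := [SubChoice_isSubIntegralDomain of realsub by <:].
HB.instance Definition _ := [SubIntegralDomain_isSubField of realsub by <:].

Let le (x y : realsub) := rsval x <= rsval y.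
Let lt (x y : realsub) := rsval x < rsval y.
Let norm (x : realsub) := RealSub (normr_real (rsval x)).

Let le0_add x y : le 0 x -> le 0 y -> le 0 (x + y).
Proof. exact: addr_ge0. Qed.
Let le0_mul x y : le 0 x -> le 0 y -> le 0 (x * y).
Proof. exact: mulr_ge0. Qed.
Let le0_anti x : le 0 x -> le x 0 -> x = 0.
Proof. by move=> h1 h2; apply/val_inj/le_anti/andP; split. Qed.
Let sub_ge0 x y : le 0 (y - x) = le x y.
Proof. exact: subr_ge0. Qed.
Let le0_total x : le 0 x || le x 0.
Proof. exact: rsvalP. Qed.
Let normN x : norm (- x) = norm x.
Proof. exact/val_inj/normrN. Qed.
Let ge0_norm x : le 0 x -> norm x = x.
Proof. by move=> h; apply/val_inj/ger0_norm. Qed.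
Let lt_def x y : lt x y = (y != x) && le x y.
Proof. by rewrite /lt lt_def. Qed.

HB.instance Definition _ := Num.IntegralDomain_isLeReal.Build realsub
  le0_add le0_mul le0_anti sub_ge0 le0_total normN ge0_norm lt_def.

Fact rsval_is_zmod_morphism : zmod_morphism rsval. Proof. by []. Qed.
Fact rsval_is_monoid_morphism : monoid_morphism rsval. Proof. by []. Qed.
HB.instance Definition _ :=
  GRing.isZmodMorphism.Build realsub C rsval rsval_is_zmod_morphism.
HB.instance Definition _ :=
  GRing.isMonoidMorphism.Build realsub C rsval rsval_is_monoid_morphism.

(** Strong induction on the size, using a root of [p] in [C]. A real root lies in the interval or
    gives a linear factor of constant sign there; a nonreal one gives a quadratic factor that is
    positive everywhere. Such factors divide out without disturbing the sign condition. *)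
Lemma realsub_poly_ivt (p : {poly realsub}) a b : a <= b ->
  p.[a] * p.[b] <= 0 -> exists2 c, a <= c <= b & root p c.
Proof.
move=> le_ab; have [n] := ubnP (size p); elim: n p => // n IHn p.
rewrite ltnS => size_p pab.
have [->|p0] := eqVneq p 0; first by exists a; rewrite ?lexx ?root0.
have [/eqP/size_poly1P [c c0 pc]|size1] := eqVneq (size p) 1.
  by move: pab; rewrite pc !hornerC -expr2 leNgt exprn_even_gt0 //= c0.
have cut q r : p = q * r -> (1 < size r)%N -> 0 < r.[a] * r.[b] ->
  exists2 c, a <= c <= b & root p c.
  move=> pqr r1 rab; have [q0 r0] : q != 0 /\ r != 0.
    by apply/andP; rewrite -negb_or -mulf_eq0 -pqr.
  have [||c cab qc] := IHn q.
  - apply: leq_trans size_p; rewrite pqr size_mul //.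
    by case: (size r) r1 => [|[|k]] // _; rewrite !addnS /= ltnS leq_addr.
  - by move: pab; rewrite pqr !hornerM mulrACA pmulr_lle0.
  by exists c; rewrite // pqr rootM qc.
have /closed_rootP [z pz] : size (map_poly rsval p) != 1 by rewrite size_map_poly.
have [zR|zNR] := boolP (z \is Num.real).
  pose x := RealSub zR; have px : root p x by rewrite -(mapf_root rsval).
  have [xab|xNab] := boolP (a <= x <= b); first by exists x.
  have /factor_theorem [q pq] := px; apply: (cut _ _ pq); first by rewrite size_XsubC.
  rewrite !hornerXsubC; move: xNab; rewrite negb_and -!ltNge => /orP [xa|bx].
    by rewrite mulr_gt0 // subr_gt0 // (lt_le_trans xa).
  by rewrite nmulr_lgt0 subr_lt0 // (le_lt_trans le_ab).
pose u := RealSub (Creal_Re z); pose v := RealSub (Creal_Im z).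
have v0 : v != 0 by apply: contraNN zNR => /eqP /(congr1 rsval) vz; apply/Creal_ImP.
pose r := ('X - u%:P) ^+ 2 + (v ^+ 2)%:P.
have rgt0 x : 0 < r.[x].
  by rewrite !hornerE ltr_wpDl ?sqr_ge0 // exprn_even_gt0.
have size_r : size r = 3.
  by rewrite size_polyDl size_exp_XsubC // size_polyC; case: eqP.
have rz : (map_poly rsval r).[z] = 0.
  rewrite rmorphD rmorphXn rmorphB /=  map_polyX !map_polyC /= !hornerE.
  rewrite {1}[z]Crect; rewrite [_ + 'i * _]addrC addrK exprMn sqrCi.
  by rewrite mulN1r -expr2 addNr.
(* The remainder has degree at most one and real coefficients, and it vanishes at the nonreal
   [z]. *)
have pr0 : p %% r = 0.
  have : (size (p %% r)%R <= 2)%N.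
    by have := ltn_modp p r; rewrite -size_poly_gt0 size_r.
  have : (map_poly rsval (p %% r)).[z] = 0.
    move: pz; rewrite rootE {1}(divp_eq p r) rmorphD rmorphM hornerD hornerM rz.
    by rewrite mulr0 add0r => /eqP.
  move: (p %% r) => m mz size_m.
  have mE : m = m`_1 *: 'X + (m`_0)%:P.
    apply/polyP => [[|[|i]]]; rewrite !coefE ?mulr0 ?mulr1 ?addr0 ?add0r //.
    by rewrite nth_default // (leq_trans size_m).
  move: mz; rewrite mE rmorphD /= map_polyZ map_polyX map_polyC /= !hornerE.
  have [-> /= |m1] := eqVneq m`_1 0.
    rewrite mul0r add0r scale0r add0r => m0.
    by apply/eqP; rewrite polyC_eq0; apply/eqP/val_inj.
  move/(canRL (addrK _)); rewrite add0r => /(canRL (mulKf _)) zE.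
  case/negP: zNR; rewrite zE ?rpredM ?rpredV ?rpredN ?rsvalP //.
apply: (cut (p %/ r) r); rewrite ?size_r ?mulr_gt0 //.
by rewrite {1}(divp_eq p r) pr0 addr0.
Qed.

Lemma realsub_real_closed : Num.real_closed_axiom realsub.
Proof.
move=> p a b le_ab /andP [pa pb].
by apply: realsub_poly_ivt; rewrite // mulr_le0_ge0.
Qed.
HB.instance Definition _ :=
  Num.RealField_isClosed.Build realsub realsub_real_closed.

End RealSubfield.

(** * Definable sets over a real closed field *)

Section DefinableSets.
Variable F : rcfType.
Local Notation env := (nat -> F).
Implicit Types (x z : env) (P Q : env -> Prop).

(** For nonzero [p] the breakpoints are its real roots: different signs at [a] and [b] force a root
    between them, endpoints included. *)
Lemma sgr_horner_constant (p : {poly F}) : exists s : seq F,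
  forall a b, a <= b -> {in s, forall c, ~~ (a <= c <= b)} ->
  Num.sg p.[a] = Num.sg p.[b].
Proof.
have [->|p0] := eqVneq p 0; first by exists [::] => a b; rewrite !horner0.
exists (rootsR p) => a b le_ab noroot; apply/eqP; apply: contraT => sgab.
have [|c cab pc] := @polyrcf.poly_ivt _ p a b le_ab.
  by move: sgab; rewrite -sgr_le0 sgrM; do 2![case: sgrP => _];
    rewrite ?eqxx ?mulr1 ?mul1r ?mulrN1 ?mulr0 ?mul0r ?opprK ?lexx ?lerN10 ?oppr0 ?lexx.
rewrite in_itv /= in cab.
by have := noroot c; rewrite -(roots_on_rootsR p0) !inE pc cab => /(_ isT).
Qed.

(** Along one coordinate an atom compares two univariate polynomials, and connectives merge finite
    lists of breakpoints. This is o-minimality for quantifier-free formulas. *)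
Lemma qf_eval_piecewise_constant e i (f : ord.formula F) :
  ord.qf_form f && ord.rformula f -> exists s : seq F,
  forall a b, a <= b -> {in s, forall c, ~~ (a <= c <= b)} ->
  ord.qf_eval (set_nth 0 e i a) f = ord.qf_eval (set_nth 0 e i b) f.
Proof.
have atom t1 t2 : GRing.rterm t1 && GRing.rterm t2 -> exists s : seq F,
  forall a b, a <= b -> {in s, forall c, ~~ (a <= c <= b)} ->
  Num.sg (GRing.eval (set_nth 0 e i a) t1 - GRing.eval (set_nth 0 e i a) t2)
  = Num.sg (GRing.eval (set_nth 0 e i b) t1 - GRing.eval (set_nth 0 e i b) t2).
  case/andP => r1 r2; pose q t := eval_poly e (abstrX i (to_rterm t)).
  have qE t y : GRing.rterm t -> (q t).[y] = GRing.eval (set_nth 0 e i y) t.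
    by move=> rt; rewrite abstrXP evalE to_rtermE.
  have [s sP] := sgr_horner_constant (q t1 - q t2).
  by exists s => a b ab /(sP _ _ ab); rewrite !hornerD !hornerN !qE.
have binop (g : bool -> bool -> bool) (u v : F -> bool) :
    (exists s : seq F, forall a b, a <= b ->
       {in s, forall c, ~~ (a <= c <= b)} -> u a = u b) ->
    (exists s : seq F, forall a b, a <= b ->
       {in s, forall c, ~~ (a <= c <= b)} -> v a = v b) ->
    exists s : seq F, forall a b, a <= b ->
      {in s, forall c, ~~ (a <= c <= b)} -> g (u a) (v a) = g (u b) (v b).
  move=> [s sP] [r rP]; exists (s ++ r) => a b ab no.
  by rewrite (sP a b) ?(rP a b) // => c cs; apply: no; rewrite mem_cat cs ?orbT.
elim: f => //=.
- by move=> b _; exists [::].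
- move=> t1 t2 /atom [s sP]; exists s => a b ab /(sP _ _ ab) sg_eq.
  by rewrite -subr_eq0 -sgr_eq0 sg_eq sgr_eq0 subr_eq0.
- move=> t1 t2 /atom [s sP]; exists s => a b ab /(sP _ _ ab) sg_eq.
  by rewrite -subr_lt0 -sgr_lt0 sg_eq sgr_lt0 subr_lt0.
- move=> t1 t2 /atom [s sP]; exists s => a b ab /(sP _ _ ab) sg_eq.
  by rewrite -subr_le0 -sgr_le0 sg_eq sgr_le0 subr_le0.
- by move=> f IHf g IHg; rewrite andbACA => /andP [/IHf ? /IHg]; apply: binop.
- by move=> f IHf g IHg; rewrite andbACA => /andP [/IHf ? /IHg]; apply: binop.
- by move=> f IHf g IHg; rewrite andbACA => /andP [/IHf ? /IHg]; apply: binop.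
- by move=> f IHf /IHf h; apply: (binop (fun b _ => ~~ b) _ _ h h).
Qed.

Definition is_sup (D : F -> Prop) s :=
  (forall y, D y -> y <= s) /\ (forall u, (forall y, D y -> y <= u) -> s <= u).

Lemma min_in_seq (s : seq F) (Q : F -> Prop) c : c \in s -> Q c ->
  exists2 m, m \in s /\ Q m & forall d, d \in s -> Q d -> m <= d.
Proof.
elim: s c => // d s IHs c; rewrite inE => cs Qc.
have [[m [ms Qm] mmin]|none] :
    (exists2 m, m \in s /\ Q m & forall d, d \in s -> Q d -> m <= d) \/
    (forall e, e \in s -> ~ Q e).
- case: (classic (exists2 e, e \in s & Q e)) => [[e es Qe]|none].
    by left; apply: IHs es Qe.
  by right => e es Qe; apply: none; exists e.
- case: (classic (Q d /\ d <= m)) => [[Qd dm]|h].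
    exists d; first by rewrite mem_head.
    move=> e; rewrite inE => /predU1P [-> //|es Qe].
    exact: le_trans dm (mmin _ es Qe).
  exists m; first by rewrite inE ms orbT.
  move=> e; rewrite inE => /predU1P [->|]; last exact: mmin.
  by move=> Qd; case: leP => // /ltW dm; case: h.
- case/predU1P: cs => [cd|cs]; last by case: (none c).
  exists d; first by rewrite mem_head -cd.
  by move=> e; rewrite inE => /predU1P [-> //|es /none]; case.
Qed.

(* The supremum is the least breakpoint bounding the set from above. *)
Lemma piecewise_constant_sup (D : F -> Prop) (s : seq F) y0 ub :
  (forall a b, a <= b -> {in s, forall c, ~~ (a <= c <= b)} -> D a -> D b) ->
  D y0 -> (forall y, D y -> y <= ub) -> exists t, is_sup D t.
Proof.
move=> constD Dy0 Dub; pose Q c := forall y, D y -> y <= c.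
pose maxs (r : seq F) := foldr Num.max y0 r.
have maxsP (r : seq F) c : c \in r -> c <= maxs r.
  elim: r => // d r IHr; rewrite inE /= le_max => /predU1P [->|/IHr ->].
    by rewrite lexx.
  by rewrite orbT.
have above (r : seq F) : (forall c, c \in r -> ~ Q c) ->
    exists2 y, D y & forall c, c \in r -> c < y.
  elim: r => [|c r IHr] nQ; first by exists y0.
  have [|y Dy yr] := IHr; first by move=> d dr; apply: nQ; rewrite inE dr orbT.
  have [z Dz cz] : exists2 z, D z & c < z.
    apply: NNPP => h; apply: (nQ c); first exact: mem_head.
    by move=> z Dz; case: leP => // cz; case: h; exists z.
  have Dm : D (Num.max y z) by rewrite /Num.max; case: ifP.
  exists (Num.max y z) => // d; rewrite inE lt_max => /predU1P [->|/yr ->//].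
  by rewrite cz orbT.
(* Otherwise some point of [D] lies beyond all breakpoints, and [D] would contain
   [Num.max y ub + 1], above its own bound. *)
have [c cs Qc] : exists2 c, c \in s & Q c.
  apply: NNPP => h; have [c cs Qc|y Dy ys] := above s; first by apply: h; exists c.
  have /Dub : D (Num.max y ub + 1).
    apply: constD Dy; first by rewrite ler_wpDr // le_max lexx.
    by move=> c /ys cy; rewrite negb_and -ltNge cy.
  rewrite leNgt; case/negP; apply: le_lt_trans (_ : Num.max y ub < _).
    by rewrite le_max lexx orbT.
  by rewrite ltrDl.
have [m [ms Qm] mmin] := min_in_seq cs Qc.
exists m; split=> // u Qu; rewrite leNgt; apply/negP => um.
(* If [u < m] bounded [D], some [y] in [D] would pass all breakpoints below [m]. No breakpoint
   separates it from the midpoint [v], so [v] would be in [D] although [u < v]. *)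
have [d|y Dy yr] := above [seq d <- s | d < m].
  rewrite mem_filter => /andP [dm ds] /(mmin _ ds).
  by rewrite leNgt dm.
have [uv vm] := midf_lt um; set v := (u + m) / 2 in uv vm.
have /Qu : D v; last by rewrite leNgt uv.
apply: (constD y) => //; first exact: le_trans (Qu _ Dy) (ltW uv).
move=> d ds; apply/negP => /andP [yd dv].
have : d < y by apply: yr; rewrite mem_filter ds (le_lt_trans dv vm).
by rewrite ltNge yd.
Qed.

(** * Definable predicates and quantifier elimination *)

Definition upd x i y : env := fun j => if j == i then y else x j.

(** Formulas are evaluated at finite sequences, which stand for environments that are eventually
    zero. *)
Definition definable P :=
  exists f : ord.formula F, forall e : seq F, ord.holds e f <-> P (nth 0 e).

Lemma definable_sup P i y0 ub :
  let D y := P (upd (fun=> 0) i y) in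
  definable P -> D y0 -> (forall y, D y -> y <= ub) -> exists t, is_sup D t.
Proof.
move=> D [f fP].
pose g := ord.quantifier_elim (@wproj F) (ord.to_rform f).
have DE y : D y <-> ord.qf_eval (set_nth 0 [::] i y) g.
  have -> : D y <-> P (nth 0 (set_nth 0 [::] i y)).
    rewrite /D (_ : upd _ _ _ = nth 0 (set_nth 0 [::] i y)) //.
    by apply: functional_extensionality => j; rewrite nth_set_nth /= nth_nil.
  by rewrite -fP; split=> /rcf_satP.
have gwf : ord.qf_form g && ord.rformula g.
  exact/ord.quantifier_elim_wf/ord.to_rform_rformula/(@wf_QE_wproj F).
have [s sP] := qf_eval_piecewise_constant [::] i gwf.
apply: (@piecewise_constant_sup _ s) => a b ab /(sP _ _ ab) h.
by rewrite !DE h.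
Qed.

Lemma definable_iff P Q : (forall x, P x <-> Q x) -> definable P -> definable Q.
Proof. by move=> PQ [f fP]; exists f => e; rewrite fP. Qed.

Lemma definable_and P Q :
  definable P -> definable Q -> definable (fun x => P x /\ Q x).
Proof. by move=> [f fP] [g gQ]; exists (ord.And f g) => e /=; rewrite fP gQ. Qed.

Lemma definable_imp P Q :
  definable P -> definable Q -> definable (fun x => P x -> Q x).
Proof.
by move=> [f fP] [g gQ]; exists (ord.Implies f g) => e /=; rewrite fP gQ.
Qed.

Lemma nth_set_nth_upd (e : seq F) i y :
  nth 0 (set_nth 0 e i y) = upd (nth 0 e) i y.
Proof.
by apply: functional_extensionality => j; rewrite nth_set_nth.
Qed.

Lemma definable_exists P i :
  definable P -> definable (fun x => exists y, P (upd x i y)).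
Proof.
move=> [f fP]; exists (ord.Exists i f) => e /=.
by split=> -[y]; rewrite -?nth_set_nth_upd ?fP => h; exists y;
  rewrite -?nth_set_nth_upd ?fP // -nth_set_nth_upd.
Qed.

Lemma definable_forall P i :
  definable P -> definable (fun x => forall y, P (upd x i y)).
Proof.
move=> [f fP]; exists (ord.Forall i f) => e /=.
by split=> h y; have := h y; rewrite fP nth_set_nth_upd.
Qed.

(** Only the first [k] coordinates of [z] count, so quantifying over the environment [z] amounts to
    a block of [k] quantifiers. *)
Definition mix k z x : env := fun j => if (j < k)%N then z j else x j.

Lemma definable_forall_mix P k :
  definable P -> definable (fun x => forall z, P (mix k z x)).
Proof.
elim: k P => [|k IHk] P dP.
  apply: definable_iff dP => x; have mE z : mix 0 z x = x by [].
  by split=> [h z|h]; rewrite ?mE //; have := h x.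
apply: definable_iff (IHk _ (definable_forall k dP)) => x.
have mE z y : upd (mix k z x) k y = mix k.+1 (upd z k y) x.
  apply: functional_extensionality => j; rewrite /upd /mix ltnS.
  by case: (ltngtP j k).
split=> [h z|h z y]; last by rewrite mE.
have := h z (z k); rewrite mE (_ : upd z k (z k) = z) //.
by apply: functional_extensionality => j; rewrite /upd; case: eqP => [->|].
Qed.

Lemma definable_all_lt (P : nat -> env -> Prop) k :
  (forall i, (i < k)%N -> definable (P i)) ->
  definable (fun x => forall i, (i < k)%N -> P i x).
Proof.
elim: k => [|k IHk] dP; first by exists (ord.Bool true).
have dk := definable_and (IHk (fun i ik => dP i (ltnW ik))) (dP k (ltnSn k)).
apply: definable_iff dk => x; split=> [[h hk] i|h].
  by rewrite ltnS leq_eqVlt => /predU1P [->|/h].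
by split=> [i ik|]; apply: h; rewrite ?ltnS ?(ltnW ik).
Qed.

(** * Polynomial functions *)

Inductive polyfun (k : nat) : (env -> F) -> Prop :=
| polyfun_var i of (i < k)%N : polyfun k (fun x => x i)
| polyfun_const c : polyfun k (fun=> c)
| polyfun_add p q of polyfun k p & polyfun k q : polyfun k (fun x => p x + q x)
| polyfun_mul p q of polyfun k p & polyfun k q : polyfun k (fun x => p x * q x).

Lemma polyfun_opp k p : polyfun k p -> polyfun k (fun x => - p x).
Proof.
move=> pp; have := polyfun_mul (polyfun_const k (-1)) pp.
rewrite (_ : (fun x => -1 * p x) = (fun x => - p x)) //.
by apply: functional_extensionality => x; rewrite mulN1r.
Qed.

Lemma polyfun_sub k p q :
  polyfun k p -> polyfun k q -> polyfun k (fun x => p x - q x).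
Proof. by move=> pp pq; apply: polyfun_add pp (polyfun_opp pq). Qed.

Lemma polyfun_term k p : polyfun k p ->
  exists t, forall e : seq F, GRing.eval e t = p (nth 0 e).
Proof.
elim=> [i _|c|{}p q _ [t tP] _ [u uP]|{}p q _ [t tP] _ [u uP]].
- by exists (GRing.Var _ i).
- by exists (GRing.Const c).
- by exists (GRing.Add t u) => e /=; rewrite tP uP.
- by exists (GRing.Mul t u) => e /=; rewrite tP uP.
Qed.

Lemma definable_le k p q :
  polyfun k p -> polyfun k q -> definable (fun x => p x <= q x).
Proof.
move=> /polyfun_term [t tP] /polyfun_term [u uP].
by exists (ord.Le t u) => e /=; rewrite tP uP.
Qed.

Lemma definable_lt k p q :
  polyfun k p -> polyfun k q -> definable (fun x => p x < q x).
Proof.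
move=> /polyfun_term [t tP] /polyfun_term [u uP].
by exists (ord.Lt t u) => e /=; rewrite tP uP.
Qed.

Lemma definable_eq k p q :
  polyfun k p -> polyfun k q -> definable (fun x => p x = q x).
Proof.
move=> /polyfun_term [t tP] /polyfun_term [u uP].
by exists (ord.Equal t u) => e /=; rewrite tP uP.
Qed.

Lemma polyfun_shift k p :
  polyfun k p -> polyfun k.+1 (fun x => p (fun i => x i.+1)).
Proof. by elim=> *; by [apply: polyfun_var | constructor]. Qed.

Definition close k (d : F) x z := forall i, (i < k)%N -> `|z i - x i| <= d.
Definition in_box k (B : F) x := forall i, (i < k)%N -> `|x i| <= B.

(** One constant serves as bound and as Lipschitz constant, because the product case of the
    induction needs both for each factor. *)
Lemma polyfun_lipschitz k p B : polyfun k p -> exists2 M, 0 <= M &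
  forall x z, in_box k B x -> in_box k B z -> `|p z| <= M /\
  forall d, 0 <= d -> close k d x z -> `|p z - p x| <= M * d.
Proof.
elim=> [i ik|c|{}p q _ [M M0 pM] _ [N N0 qN]|{}p q _ [M M0 pM] _ [N N0 qN]].
- exists (`|B| + 1); first by rewrite addr_ge0.
  move=> x z xB zB; split=> [|d d0 /(_ i ik) h].
    apply: le_trans (zB i ik) _; apply: le_trans (ler_norm B) _.
    by rewrite lerDl.
  by apply: le_trans h _; rewrite ler_peMl // lerDr.
- exists `|c| => // x z _ _; split=> // d d0 _.
  by rewrite subrr normr0 mulr_ge0.
- exists (M + N); first exact: addr_ge0.
  move=> x z xB zB; have [zM xM] := pM _ _ xB zB; have [zN xN] := qN _ _ xB zB.
  split=> [|d d0 cd]; first exact: le_trans (ler_normD _ _) (lerD zM zN).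
  rewrite opprD addrACA mulrDl.
  exact: le_trans (ler_normD _ _) (lerD (xM _ d0 cd) (xN _ d0 cd)).
- exists (M * N *+ 2); first by rewrite mulrn_wge0 // mulr_ge0.
  move=> x z xB zB; have [zM xM] := pM _ _ xB zB; have [zN xN] := qN _ _ xB zB.
  have [xN' _] := qN _ _ zB xB.
  split=> [|d d0 cd].
    rewrite normrM; apply: le_trans (ler_pM _ _ zM zN) _ => //.
    by rewrite mulr2n lerDl mulr_ge0.
  have -> : p z * q z - p x * q x = p z * (q z - q x) + (p z - p x) * q x.
    by rewrite mulrBr mulrBl addrA subrK.
  apply: le_trans (ler_normD _ _) _; rewrite mulr2n (mulrDl _ _ d) !normrM.
  rewrite lerD // -?mulrA.
    exact: ler_pM (xN _ d0 cd).
  by rewrite [N * d]mulrC mulrA ler_pM // (xM _ d0 cd).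
Qed.

(** * Closed bounded definable sets *)

Definition closed_set k P := forall x,
  (forall d, 0 < d -> exists2 z, P z & close k d x z) -> P x.

(** Environments that agree below [k] are at distance zero, so a closed set cannot tell them
    apart. *)
Lemma closed_set_ext k P x z : closed_set k P ->
  (forall i, (i < k)%N -> x i = z i) -> P x -> P z.
Proof.
move=> cP xz Px; apply: cP => d d0; exists x => // i /xz ->.
by rewrite subrr normr0 ltW.
Qed.

Lemma upd_id x k : upd x k (x k) = x.
Proof.
by apply: functional_extensionality => j; rewrite /upd; case: eqP => [->|].
Qed.

(* The last coordinate of the limit point is the supremum of the eventual
   lower bounds on that coordinate. *)
Lemma closed_set_proj k P B :
  definable P -> closed_set k.+1 P -> (forall x, P x -> in_box k.+1 B x) ->
  closed_set k (fun x => exists y, P (upd x k y)).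
Proof.
move=> dP cP bP x approx.
have {}approx d : 0 < d -> exists2 z, P z & close k d x z.
  move=> /approx [z [y Pz] zx]; exists (upd z k y) => // i ik.
  by rewrite /upd ltn_eqF // zx.
pose G u := exists2 d, 0 < d & forall z, P z -> close k d x z -> u <= z k.
(* [P'] expresses [G] by a formula: coordinates up to [k] hold [z], coordinate [k.+1] the candidate
   bound, and [k.+2] the radius. *)
pose P' e := exists y, 0 < upd e k.+2 y k.+2 /\ forall z,
  P (mix k.+1 z (upd e k.+2 y)) /\ (forall i, (i < k)%N ->
    (mix k.+1 z (upd e k.+2 y) i - x i <= mix k.+1 z (upd e k.+2 y) k.+2 /\
     x i - mix k.+1 z (upd e k.+2 y) i <= mix k.+1 z (upd e k.+2 y) k.+2)) ->
  mix k.+1 z (upd e k.+2 y) k.+1 <= mix k.+1 z (upd e k.+2 y) k.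
have var i : (i < k.+3)%N -> polyfun k.+3 (fun e => e i) by apply: polyfun_var.
have [k3 k13] : (k < k.+3)%N /\ (k.+1 < k.+3)%N by rewrite !ltnS !leqW.
have dP' : definable P'.
  apply: (@definable_exists (fun e => 0 < e k.+2 /\ forall z, P (mix k.+1 z e) /\
   (forall i, (i < k)%N -> mix k.+1 z e i - x i <= mix k.+1 z e k.+2 /\
      x i - mix k.+1 z e i <= mix k.+1 z e k.+2) ->
    mix k.+1 z e k.+1 <= mix k.+1 z e k)).
  apply: definable_and.
    exact: definable_lt (polyfun_const k.+3 0) (var _ (ltnSn _)).
  apply: (@definable_forall_mix (fun e => P e /\ (forall i, (i < k)%N ->
      e i - x i <= e k.+2 /\ x i - e i <= e k.+2) -> e k.+1 <= e k)).
  apply: definable_imp; last exact: definable_le (var k.+1 k13) (var k k3).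
  apply: definable_and dP _; apply: definable_all_lt => i ik.
  have ik3 : (i < k.+3)%N by do 3!apply: leqW.
  have px := polyfun_const k.+3 (x i).
  apply: definable_and; apply: definable_le (var k.+2 (ltnSn _)).
    exact: polyfun_sub (var _ ik3) px.
  exact: polyfun_sub px (var _ ik3).
have GP u : G u <-> P' (upd (fun=> 0) k.+1 u).
  have ext d z : P (mix k.+1 z (upd (upd (fun=> 0) k.+1 u) k.+2 d)) <-> P z.
    by split; apply: closed_set_ext cP _ => i ik; rewrite /mix ik.
  have mk d z : mix k.+1 z (upd (upd (fun=> 0) k.+1 u) k.+2 d) k = z k.
    by rewrite /mix ltnSn.
  have mk1 d z : mix k.+1 z (upd (upd (fun=> 0) k.+1 u) k.+2 d) k.+1 = u.
    by rewrite /mix ltnn /upd eqxx ltn_eqF.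
  have mk2 d z : mix k.+1 z (upd (upd (fun=> 0) k.+1 u) k.+2 d) k.+2 = d.
    by rewrite /mix ltnNge ltnW // /upd eqxx.
  have mi d z i : (i < k)%N ->
      mix k.+1 z (upd (upd (fun=> 0) k.+1 u) k.+2 d) i = z i.
    by move=> ik; rewrite /mix ltnS ltnW.
  split=> [[d d0 dG]|[d [d0 dG]]]; exists d.
  - split; first by rewrite /upd eqxx.
    move=> z []; rewrite ext mk mk1 mk2 => Pz zx; apply: dG => // i ik.
    by have := zx i ik; rewrite mi // ler_norml lerNl opprB => -[-> ->].
  - by move: d0; rewrite /upd eqxx.
  - move=> z Pz zx; have := dG z; rewrite ext mk mk1 mk2; apply; split=> // i ik.
    have := zx i ik; rewrite mi // ler_norml lerNl opprB.
    by move/andP => [-> ->].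
have /(_ (- B) B) [||t [tG leastt]] := definable_sup (i := k.+1) dP'.
- rewrite -GP; exists 1 => // z /bP /(_ k (ltnSn k)).
  by rewrite ler_norml => /andP [].
- move=> u; rewrite -GP => -[d d0 dG]; have [z Pz zx] := approx _ d0.
  apply: le_trans (dG _ Pz zx) _.
  by have := bP _ Pz k (ltnSn k); rewrite ler_norml => /andP [].
exists t; apply: cP => d d0.
(* Some bound in [G] exceeds [t - d], while [t + d] is not in [G]. Together they give a point of [P]
   close to [x] whose coordinate [k] is within [d] of [t]. *)
have [u [d1 d10 uG] tu] : exists2 u, G u & t - d < u.
  apply: NNPP => h; have : t <= t - d.
    apply: leastt => u; rewrite -GP => Gu; case: leP => // tu.
    by case: h; exists u.
  by rewrite lerBrDr gerDl leNgt d0.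
have [z [Pz zx] zt] : exists2 z, P z /\ close k (Num.min d d1) x z & z k < t + d.
  apply: NNPP => h; have : t + d <= t.
    apply: tG; rewrite -GP; exists (Num.min d d1); first by rewrite lt_min d0.
    by move=> z Pz zx; case: leP => // zt; case: h; exists z.
  by rewrite gerDl leNgt d0.
exists z => // i; rewrite ltnS leq_eqVlt /upd => /predU1P [->|ik].
  rewrite eqxx ler_norml lerBrDl [_ <= d]lerBlDl (ltW zt) andbT.
  have /(uG _ Pz) : close k d1 x z.
    by move=> i' ik; apply: le_trans (zx _ ik) _; rewrite ge_min lexx orbT.
  by apply: le_trans; apply: ltW.
rewrite ltn_eqF //; apply: le_trans (zx _ ik) _.
by rewrite ge_min lexx.
Qed.

(** The last coordinates are projected away one by one; the closed bounded subset of the line that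
    remains contains its supremum. *)
Lemma closed_set_max k P B z0 :
  definable P -> closed_set k.+1 P -> (forall x, P x -> in_box k.+1 B x) ->
  P z0 -> exists2 x, P x & forall z, P z -> z 0%N <= x 0%N.
Proof.
elim: k P z0 => [|k IHk] P z0 dP cP bP Pz0.
  have ext z : P (upd (fun=> 0) 0 (z 0%N)) <-> P z.
    by split; apply: closed_set_ext cP _ => -[].
  have [||t [tP leastt]] := @definable_sup P 0 (z0 0%N) B dP.
  - by rewrite ext.
  - by move=> y /bP /(_ 0%N isT); rewrite /upd eqxx ler_norml => /andP [].
  exists (upd (fun=> 0) 0 t) => [|z]; last by rewrite /upd eqxx -ext => /tP.
  apply: cP => d d0; apply: NNPP => h; have : t <= t - d.
    apply: leastt => y Py; case: leP => // ty; case: h.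
    exists (upd (fun=> 0) 0 y) => // -[] // _; rewrite /upd eqxx ler_norml.
    by rewrite lerBrDl (ltW ty) lerBlDl (le_trans (tP _ Py)) // lerDl ltW.
  by rewrite lerBrDr gerDl leNgt d0.
have [||||x [y Py] ymax] := IHk (fun x => exists y, P (upd x k.+1 y)) z0.
- exact: definable_exists.
- exact: closed_set_proj dP cP bP.
- move=> x [y /bP xyB] i ik; have := xyB i (ltnW ik).
  by rewrite /upd ltn_eqF.
- by exists (z0 k.+1); rewrite upd_id.
exists (upd x k.+1 y) => // z Pz; rewrite [leRHS]/upd /=.
by apply: ymax; exists (z k.+1); rewrite upd_id.
Qed.

(* A maximum of [q] over [Z] is a point of maximal 0-th coordinate on the graph
   of [q] over [Z], which is placed in coordinates 1, ..., k. *)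
Theorem polyfun_max k m q (p : nat -> env -> F) B :
  polyfun k q -> (forall l, (l < m)%N -> polyfun k (p l)) ->
  let Z x := in_box k B x /\ forall l, (l < m)%N -> p l x = 0 in
  (exists x, Z x) -> exists2 x, Z x & forall z, Z z -> q z <= q x.
Proof.
move=> pq pp Z [x0 Zx0]; pose sh x : env := fun i => x i.+1.
pose P x := x 0%N = q (sh x) /\ Z (sh x).
have [M M0 qM] := polyfun_lipschitz B pq.
pose glue x : env := fun i => if i is j.+1 then x j else q x.
have Pglue x : Z x -> P (glue x) by [].
(* [M] bounds the value of [q] in coordinate 0, and [B] bounds the other coordinates. *)
have [||||x [xq Zx] xmax] := @closed_set_max k P (Num.max M B) (glue x0).
- apply: definable_and.
    exact: definable_eq (polyfun_var (ltn0Sn k)) (polyfun_shift pq).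
  apply: definable_and; apply: definable_all_lt => i ik.
    pose v : polyfun k.+1 (fun x => sh x i) := polyfun_var (ik : (i.+1 < k.+1)%N).
    apply: (definable_iff (P := fun x => - B <= sh x i /\ sh x i <= B)).
      by move=> x; rewrite ler_norml; split=> /andP.
    by apply: definable_and; apply: definable_le; try exact: v;
      apply: polyfun_const.
  exact: definable_eq (polyfun_shift (pp _ ik)) (polyfun_const _ 0).
- move=> x approx.
  have {}approx d : 0 < d -> exists2 z, Z z & close k d (sh x) z /\
      `|x 0%N - q z| <= d.
    move=> /approx [z [zq Zz] zx]; exists (sh z) => //; split=> [i ik|].
      exact: zx.
    by rewrite distrC -zq zx.
  have small (a b : F) : 0 <= b -> (forall d, 0 < d -> a <= b * d) -> a <= 0.
    move=> b0 h; rewrite leNgt; apply/negP => a0.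
    have b1 : 0 < b + 1 by rewrite ltr_wpDl.
    have := h (a / (b + 1)) (divr_gt0 a0 b1).
    rewrite mulrA ler_pdivlMr // mulrC ler_pM2r // leNgt.
    by rewrite ltrDl ltr01.
  have xB : in_box k B (sh x).
    move=> i ik; rewrite -subr_le0; apply: (small _ 1) => // d /approx.
    case=> z [/(_ i ik) zB _] [/(_ i ik) zx _].
    rewrite mul1r lerBlDl -(subrK (z i) (sh x i)).
    by rewrite (le_trans (ler_normD _ _)) // addrC lerD // distrC.
  split.
    apply/eqP; rewrite -subr_eq0 -normr_le0; apply: (small _ (1 + M)).
      exact: addr_ge0.
    move=> d d0; have [z [zB _] [zx xz]] := approx _ d0.
    have [_ /(_ _ (ltW d0) zx)] := qM _ _ xB zB; rewrite mulrDl mul1r => h.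
    rewrite -(subrK (q z) (x 0%N)) -addrA.
    exact: le_trans (ler_normD _ _) (lerD xz h).
  split=> // l lm; have [N N0 pN] := polyfun_lipschitz B (pp l lm).
  apply/eqP; rewrite -normr_le0; apply: (small _ N) => // d d0.
  have [z [zB zp] [zx _]] := approx _ d0.
  have [_ /(_ _ (ltW d0) zx)] := pN _ _ xB zB.
  by rewrite zp // sub0r normrN.
- move=> x [xq [xB _]] [|i] ik; rewrite le_max; last by rewrite xB ?orbT.
  by rewrite xq; have [-> _] := qM _ _ xB xB.
- exact: Pglue.
exists (sh x) => // z /Pglue /xmax /=.
by rewrite xq.
Qed.

End DefinableSets.

(** * Maxima over isometries *)

Section IsometryMax.
Variable C : numClosedFieldType.
Local Notation R := (realsub C).
Local Notation env := (nat -> R).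

Definition re_sub (c : C) : R := RealSub (Creal_Re c).
Definition im_sub (c : C) : R := RealSub (Creal_Im c).

(** Conjugation becomes polynomial once real and imaginary parts are separated. *)
Definition cpolyfun k (f : env -> C) :=
  polyfun k (fun x => re_sub (f x)) /\ polyfun k (fun x => im_sub (f x)).

Lemma polyfun_eq k (p q : env -> R) : p =1 q -> polyfun k p -> polyfun k q.
Proof. by move=> /functional_extensionality ->. Qed.

Lemma cpolyfun_eq k (f g : env -> C) : f =1 g -> cpolyfun k f -> cpolyfun k g.
Proof. by move=> /functional_extensionality ->. Qed.

Lemma cpolyfun_const k c : cpolyfun k (fun=> c).
Proof. by split; apply: polyfun_const. Qed.

Lemma cpolyfun_add k f g :
  cpolyfun k f -> cpolyfun k g -> cpolyfun k (fun x => f x + g x).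
Proof.
move=> [f1 f2] [g1 g2]; split.
  by apply: polyfun_eq (polyfun_add f1 g1) => x; apply/val_inj; rewrite /= raddfD.
by apply: polyfun_eq (polyfun_add f2 g2) => x; apply/val_inj; rewrite /= raddfD.
Qed.

Lemma cpolyfun_mul k f g :
  cpolyfun k f -> cpolyfun k g -> cpolyfun k (fun x => f x * g x).
Proof.
move=> [f1 f2] [g1 g2]; split.
  apply: polyfun_eq (polyfun_sub (polyfun_mul f1 g1) (polyfun_mul f2 g2)) => x.
  by apply/val_inj; rewrite /= ReM.
apply: polyfun_eq (polyfun_add (polyfun_mul f1 g2) (polyfun_mul g1 f2)) => x.
by apply/val_inj; rewrite /= ImM.
Qed.

Lemma cpolyfun_conj k f : cpolyfun k f -> cpolyfun k (fun x => (f x)^*).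
Proof.
move=> [f1 f2]; split.
  by apply: polyfun_eq f1 => x; apply/val_inj; rewrite /= Re_conj.
by apply: polyfun_eq (polyfun_opp f2) => x; apply/val_inj; rewrite /= Im_conj.
Qed.

Lemma cpolyfun_sum k (I : Type) (r : seq I) (f : I -> env -> C) :
  (forall i, cpolyfun k (f i)) -> cpolyfun k (fun x => \sum_(i <- r) f i x).
Proof.
move=> pf; elim: r => [|i r IHr].
  by apply: cpolyfun_eq (cpolyfun_const k 0) => x; rewrite big_nil.
by apply: cpolyfun_eq (cpolyfun_add (pf i) IHr) => x; rewrite big_cons.
Qed.

Definition mpolyfun k m n (A : env -> 'M[C]_(m, n)) :=
  forall i j, cpolyfun k (fun x => A x i j).

Lemma mpolyfun_const k m n (A : 'M[C]_(m, n)) : mpolyfun k (fun=> A).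
Proof. by move=> i j; apply: cpolyfun_const. Qed.

Lemma mpolyfun_mul k m n p (A : env -> 'M[C]_(m, n)) (B : env -> 'M[C]_(n, p)) :
  mpolyfun k A -> mpolyfun k B -> mpolyfun k (fun x => A x *m B x).
Proof.
move=> pA pB i j; apply: cpolyfun_eq (fun x => esym (mxE _ _ _ _)) _.
by apply: cpolyfun_sum => l; apply: cpolyfun_mul.
Qed.

Lemma mpolyfun_adj k m n (A : env -> 'M[C]_(m, n)) :
  mpolyfun k A -> mpolyfun k (fun x => adj (A x)).
Proof.
move=> pA i j; apply: cpolyfun_eq (cpolyfun_conj (pA j i)) => x.
by rewrite !mxE.
Qed.

Lemma cpolyfun_trace k n (A : env -> 'M[C]_n) :
  mpolyfun k A -> cpolyfun k (fun x => \tr (A x)).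
Proof. by move=> pA; apply: cpolyfun_sum => i; apply: pA. Qed.

Section Coordinates.
Variables m n : nat.
Local Notation idx := ('I_m * 'I_n * bool)%type.
Local Notation K := #|{: idx}|.

Definition mx_of_env (x : env) : 'M[C]_(m, n) := \matrix_(i, j)
  (rsval (x (enum_rank ((i, j), false))) +
   'i * rsval (x (enum_rank ((i, j), true)))).

Definition env_of_mx (V : 'M[C]_(m, n)) : env := fun l =>
  if insub l is Some t then
    let: (i, j, b) := enum_val (t : 'I_K) in
    if b then im_sub (V i j) else re_sub (V i j)
  else 0.

Lemma env_of_mxK V : mx_of_env (env_of_mx V) = V.
Proof.
apply/matrixP => i j; rewrite mxE /env_of_mx !valK !enum_rankK /=.
by rewrite -Crect.
Qed.

Lemma mpolyfun_mx_of_env : mpolyfun K mx_of_env.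
Proof.
have var (t : idx) : polyfun K (fun x : env => x (enum_rank t)).
  exact: polyfun_var (ltn_ord _).
move=> i j; split; [apply: polyfun_eq (var (i, j, false))
                   |apply: polyfun_eq (var (i, j, true))] => x;
  by apply/val_inj; rewrite /= mxE ?Re_rect ?Im_rect ?rsvalP.
Qed.

(** Column [j] has norm one. *)
Lemma isometry_entry_le1 (V : 'M[C]_(m, n)) i j :
  adj V *m V = 1%:M -> `|V i j| <= 1.
Proof.
move=> /matrixP /(_ j j); rewrite !mxE eqxx => VV.
rewrite -(@ler_pXn2r _ 2) ?nnegrE // expr1n -[leRHS]VV.
rewrite (bigD1 i) //= !mxE mulrC -normCK lerDl sumr_ge0 // => l _.
by rewrite !mxE mulrC -normCK exprn_ge0.
Qed.

(** Real and imaginary parts of the entries of [adj V *m V - 1%:M] cut out the isometries as a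
    bounded real algebraic set, on which the real polynomial [h] attains its maximum. *)
Theorem isometry_max k (D : 'I_k -> 'M[C]_m) (X : 'I_k -> 'M[C]_n) :
  let h (V : 'M[C]_(m, n)) : C := \sum_i \tr (D i *m V *m X i *m adj V) in
  (forall V, h V \is Num.real) -> (exists V : 'M[C]_(m, n), adj V *m V = 1%:M) ->
  exists2 V : 'M[C]_(m, n), adj V *m V = 1%:M &
    forall W : 'M[C]_(m, n), adj W *m W = 1%:M -> h W <= h V.
Proof.
move=> h hR [V0 V0iso].
pose q (x : env) : R := re_sub (h (mx_of_env x)).
pose idx' := ('I_n * 'I_n * bool)%type.
pose gram (x : env) := adj (mx_of_env x) *m mx_of_env x - 1%:M.
pose p l (x : env) : R := if insub l is Some t then
  let: (i, j, b) := enum_val (t : 'I_#|{: idx'}|) in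
  if b then im_sub (gram x i j) else re_sub (gram x i j) else 0.
have pV := mpolyfun_mx_of_env; have pVa := mpolyfun_adj pV.
have [pq _] : cpolyfun K (fun x => h (mx_of_env x)).
  apply: cpolyfun_sum => i; apply: cpolyfun_trace; apply: mpolyfun_mul pVa.
  by apply: mpolyfun_mul (mpolyfun_const _ _); apply: mpolyfun_mul pV;
    apply: mpolyfun_const.
have pgram i j : cpolyfun K (fun x => gram x i j).
  apply: cpolyfun_eq (fun x => esym (mxE _ _ _ _)) _.
  by apply: cpolyfun_add (cpolyfun_const _ _); apply: mpolyfun_mul pVa pV _ _.
have pp l : (l < #|{: idx'}|)%N -> polyfun K (p l).
  move=> lK; rewrite /p (insubT (fun l => l < #|{: idx'}|)%N lK) /=.
  case: (enum_val _) => -[i j] b; have [p1 p2] := pgram i j; by case: b.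
have gramP x : (forall l, (l < #|{: idx'}|)%N -> p l x = 0) <->
    adj (mx_of_env x) *m mx_of_env x = 1%:M.
  split=> [pl0|iso l lK].
    apply/eqP; rewrite -subr_eq0; apply/eqP/matrixP => i j.
    rewrite [RHS]mxE [LHS]Crect.
    have := pl0 (enum_rank ((i, j), false)) (ltn_ord _).
    have := pl0 (enum_rank ((i, j), true)) (ltn_ord _).
    rewrite /p !valK !enum_rankK => /(congr1 (@rsval _)) /= ->.
    by move=> /(congr1 (@rsval _)) /= ->; rewrite mulr0 addr0.
  rewrite /p (insubT (fun l => l < #|{: idx'}|)%N lK) /gram iso subrr /=.
  case: (enum_val _) => -[i j] [] /=; apply/val_inj;
    by rewrite /= mxE raddf0.
have Zenv V : adj V *m V = 1%:M -> in_box K 1 (env_of_mx V) /\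
    forall l, (l < #|{: idx'}|)%N -> p l (env_of_mx V) = 0.
  move=> iso; split; last by apply/gramP; rewrite env_of_mxK.
  move=> l lK; rewrite /env_of_mx (insubT (fun l => l < K)%N lK) /=.
  case: (enum_val _) => -[i j] b; have := isometry_entry_le1 i j iso.
  rewrite -(@ler_pXn2r _ 2) ?nnegrE // expr1n normC2_Re_Im => le1.
  suff: `|rsval (if b then im_sub (V i j) else re_sub (V i j))| <= 1 by [].
  rewrite -(@ler_pXn2r _ 2) ?nnegrE // expr1n (le_trans _ le1) //.
  case: b => /=; rewrite real_normK ?Creal_Re ?Creal_Im //.
    by rewrite lerDr real_exprn_even_ge0 // Creal_Re.
  by rewrite lerDl real_exprn_even_ge0 // Creal_Im.
have [|x [xB /gramP xiso] xmax] := @polyfun_max _ K _ q p 1 pq pp.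
  by exists (env_of_mx V0); apply: Zenv.
exists (mx_of_env x) => // W /Zenv /xmax.
rewrite /q env_of_mxK => le_re.
have : 'Re (h W) <= 'Re (h (mx_of_env x)) by [].
by rewrite !(Creal_ReP _ _).
Qed.

End Coordinates.
End IsometryMax.

(** * Positive semidefinite matrices *)

Section MatrixAnalysis.
Variable C : numClosedFieldType.

Lemma adjE m n (A : 'M[C]_(m, n)) i j : adj A i j = (A j i)^*.
Proof. by rewrite !mxE. Qed.

Lemma adjK m n (A : 'M[C]_(m, n)) : adj (adj A) = A.
Proof. exact: trmxCK. Qed.

Lemma adjM m n p (A : 'M[C]_(m, n)) (B : 'M[C]_(n, p)) :
  adj (A *m B) = adj B *m adj A.
Proof. by rewrite /adj trmx_mul map_mxM. Qed.

Lemma adj_id n : adj (1%:M : 'M[C]_n) = 1%:M.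
Proof. by rewrite /adj trmx1 map_mx1. Qed.

Lemma adjD m n (A B : 'M[C]_(m, n)) : adj (A + B) = adj A + adj B.
Proof. by rewrite /adj linearD /= map_mxD. Qed.

Lemma adjN m n (A : 'M[C]_(m, n)) : adj (- A) = - adj A.
Proof. by rewrite /adj linearN /= map_mxN. Qed.

Lemma adjB m n (A B : 'M[C]_(m, n)) : adj (A - B) = adj A - adj B.
Proof. by rewrite adjD adjN. Qed.

Lemma adj0 m n : adj (0 : 'M[C]_(m, n)) = 0.
Proof. by rewrite /adj trmx0 map_mx0. Qed.

Lemma adj_scale m n c (A : 'M[C]_(m, n)) : adj (c *: A) = c^* *: adj A.
Proof. by rewrite /adj linearZ /= map_mxZ. Qed.

Lemma adj_sum m n (I : Type) (r : seq I) (P : pred I) (A : I -> 'M[C]_(m, n)) :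
  adj (\sum_(i <- r | P i) A i) = \sum_(i <- r | P i) adj (A i).
Proof. exact: (big_morph _ (@adjD m n) (@adj0 m n)). Qed.

Lemma trace_adj n (A : 'M[C]_n) : \tr (adj A) = (\tr A)^*.
Proof. by rewrite /adj trace_map_mx mxtrace_tr. Qed.

Lemma adj_diag n (d : 'rV[C]_n) :
  (forall i, 0 <= d 0 i) -> adj (diag_mx d) = diag_mx d.
Proof.
move=> d0; apply/matrixP => i j; rewrite adjE !mxE eq_sym.
case: eqP => [->|_]; last by rewrite !mulr0n rmorph0.
by rewrite !mulr1n; apply: conj_Creal; apply: ger0_real.
Qed.

Lemma trace_mul_adj m n (A : 'M[C]_(m, n)) :
  \tr (A *m adj A) = \sum_i \sum_j `|A i j| ^+ 2.
Proof.
apply: eq_bigr => i _; rewrite mxE; apply: eq_bigr => j _.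
by rewrite adjE normCK.
Qed.

Lemma trace_mul_adj_ge0 m n (A : 'M[C]_(m, n)) : 0 <= \tr (A *m adj A).
Proof.
by rewrite trace_mul_adj; do 2!apply: sumr_ge0 => ? _; rewrite exprn_ge0.
Qed.

Lemma trace_mul_adj_eq0 m n (A : 'M[C]_(m, n)) : \tr (A *m adj A) = 0 -> A = 0.
Proof.
rewrite trace_mul_adj => /eqP; rewrite psumr_eq0 => [/allP A0|i _].
  apply/matrixP => i j; rewrite mxE; apply/eqP.
  have := A0 i; rewrite mem_index_enum => /(_ isT) /=.
  rewrite psumr_eq0 => [/allP /(_ j)|l _]; last by rewrite exprn_ge0.
  by rewrite mem_index_enum => /(_ isT) /=; rewrite sqrf_eq0 normr_eq0.
by apply: sumr_ge0 => ? _; rewrite exprn_ge0.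
Qed.

(** The squared norm of [b *: A - c *: adj B] is nonnegative and equals [b] times the difference of
    the two sides; if [b = 0] then [B] vanishes. *)
Lemma trace_cauchy_schwarz m n (A : 'M[C]_(m, n)) (B : 'M[C]_(n, m)) :
  `|\tr (A *m B)| ^+ 2 <= \tr (A *m adj A) * \tr (adj B *m B).
Proof.
set a := \tr (A *m adj A); set b := \tr (adj B *m B); set c := \tr (A *m B).
have b0 : 0 <= b by have := trace_mul_adj_ge0 (adj B); rewrite adjK.
have [b_eq0|b_neq0] := eqVneq b 0.
  have B0 : adj B = 0 by apply: trace_mul_adj_eq0; rewrite adjK.
  by rewrite /c -(adjK B) B0 adj0 mulmx0 mxtrace0 normr0 expr0n mulr_ge0 //
    trace_mul_adj_ge0.
have := trace_mul_adj_ge0 (b *: A - c *: adj B).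
rewrite adjB !adj_scale adjK mulmxBl !mulmxBr -!scalemxAl -!scalemxAr !scalerA.
rewrite !raddfB /= !linearZ /= -/a -/b -/c.
have -> : \tr (adj B *m adj A) = c^* by rewrite -adjM trace_adj.
have bE : b^* = b by apply: conj_Creal; apply: ger0_real.
rewrite bE (_ : _ + _ = b * (a * b - c * c^*)); last by ring.
by rewrite pmulr_rge0 ?lt_def ?b_neq0 // subr_ge0 normCK.
Qed.

Lemma psd_gram m n (A : 'M[C]_(m, n)) : psd (adj A *m A).
Proof.
split=> [|v]; first by rewrite /Defs.hermitian adjM adjK.
rewrite mulmxA -mulmxA -adjM; set w := A *m v; rewrite mxE; apply: sumr_ge0 => i _.
by rewrite adjE mulrC mul_conjC_ge0.
Qed.

Lemma psd_conj m n (A : 'M[C]_m) (B : 'M[C]_(m, n)) :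
  psd A -> psd (adj B *m A *m B).
Proof.
move=> [hA pA]; split=> [|v]; first by rewrite /Defs.hermitian !adjM adjK hA mulmxA.
by have := pA (B *m v); rewrite adjM !mulmxA.
Qed.

Lemma psd_add n (A B : 'M[C]_n) : psd A -> psd B -> psd (A + B).
Proof.
move=> [hA pA] [hB pB]; split=> [|v]; first by rewrite /Defs.hermitian adjD hA hB.
by rewrite mulmxDr mulmxDl mxE addr_ge0.
Qed.

Lemma psdZ n c (A : 'M[C]_n) : 0 <= c -> psd A -> psd (c *: A).
Proof.
move=> c0 [hA pA]; split=> [|v].
  by rewrite /Defs.hermitian adj_scale hA conj_Creal // ger0_real.
by rewrite -scalemxAr -scalemxAl mxE mulr_ge0.
Qed.

Lemma psd_sum n (I : Type) (r : seq I) (A : I -> 'M[C]_n) :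
  (forall i, psd (A i)) -> psd (\sum_(i <- r) A i).
Proof.
move=> pA; elim: r => [|i r IHr]; rewrite ?big_nil ?big_cons.
  by have := psd_gram (0 : 'M[C]_n); rewrite mulmx0.
exact: psd_add.
Qed.

Lemma psd_spectral n (A : 'M[C]_n) : psd A -> exists (U : 'M[C]_n) (d : 'rV[C]_n),
  [/\ adj U *m U = 1%:M, U *m adj U = 1%:M, forall i, 0 <= d 0 i &
      A = adj U *m diag_mx d *m U].
Proof.
move=> [hA pA]; have /orthomx_spectralP AE : A \is normalmx.
  by apply/normalmxP; have : adj A = A := hA; rewrite /adj => ->.
have Uu := spectral_unitarymx A; have U1 := unitarymxP Uu.
rewrite invmx_unitary // in AE.
exists (spectralmx A), (spectral_diag A); split=> //; first exact: mulmx1C.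
move=> i; have := pA (adj (row i (spectralmx A))); rewrite adjK {2}AE.
have -> : adj (row i (spectralmx A)) =
    adj (spectralmx A) *m delta_mx i 0.
  by apply/matrixP => j k; rewrite -colE !mxE.
have -> : row i (spectralmx A) = delta_mx 0 i *m spectralmx A by rewrite -rowE.
rewrite !mulmxA -[delta_mx 0 i *m _ *m _]mulmxA U1 mulmx1.
rewrite -[_ *m _ *m adj _]mulmxA U1 mulmx1.
by rewrite -rowE -colE !mxE eqxx mulr1n.
Qed.

(** [sqrtm] is picked by [epsilon], so it suffices to build one root from the spectral
    decomposition. *)
Lemma sqrtm_spec n (A : 'M[C]_n) : psd A -> psd (sqrtm A) /\ sqrtm A *m sqrtm A = A.
Proof.
move=> pA; apply: (epsilon_spec _ (fun B => psd B /\ B *m B = A)).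
have [U [d [U1 U2 d0 ->]]] := psd_spectral pA.
pose s : 'rV[C]_n := map_mx sqrtC d.
have s0 i : 0 <= s 0 i by rewrite mxE sqrtC_ge0.
(* Fourth roots of the eigenvalues show [diag_mx s] to be a Gram matrix, hence positive
   semidefinite. *)
pose r : 'rV[C]_n := map_mx sqrtC s.
have sE : diag_mx s = adj (diag_mx r) *m diag_mx r.
  rewrite adj_diag => [|i]; last by rewrite mxE sqrtC_ge0.
  rewrite mulmx_diag; congr diag_mx.
  by apply/rowP => j; rewrite !mxE -expr2 sqrtCK.
exists (adj U *m diag_mx s *m U); split.
  by rewrite sE; apply/psd_conj/psd_gram.
rewrite !mulmxA -[_ *m U *m adj U]mulmxA U2 mulmx1 -(mulmxA (adj U)).
rewrite mulmx_diag; congr (_ *m diag_mx _ *m _).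
by apply/rowP => j; rewrite !mxE -expr2 sqrtCK.
Qed.

Lemma psd_gram_exists n (A : 'M[C]_n) : psd A -> exists B : 'M_n, A = adj B *m B.
Proof.
by move=> /sqrtm_spec [[hS _] SS]; exists (sqrtm A); rewrite hS SS.
Qed.

Lemma psd_trace_ge0 n (A : 'M[C]_n) : psd A -> 0 <= \tr A.
Proof.
by move=> /psd_gram_exists [B ->]; rewrite mxtrace_mulC trace_mul_adj_ge0.
Qed.

(** With Gram factors [a] and [b], the trace is the squared Hilbert-Schmidt norm of [a *m adj b]. *)
Lemma psd_trace_mul n (A B : 'M[C]_n) : psd A -> psd B ->
  0 <= \tr (A *m B) /\ (\tr (A *m B) = 0 -> A *m B = 0).
Proof.
move=> /psd_gram_exists [a ->] /psd_gram_exists [b ->].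
have -> : \tr (adj a *m a *m (adj b *m b)) =
    \tr ((a *m adj b) *m adj (a *m adj b)).
  by rewrite adjM adjK -!mulmxA [LHS]mxtrace_mulC !mulmxA.
split; first exact: trace_mul_adj_ge0.
by move=> /trace_mul_adj_eq0 ab; rewrite mulmxA -(mulmxA _ a) ab mulmx0 mul0mx.
Qed.

Lemma psd_trace_eq0 n (A : 'M[C]_n) : psd A -> \tr A = 0 -> A = 0.
Proof.
move=> /psd_gram_exists [B ->]; rewrite mxtrace_mulC => /trace_mul_adj_eq0 ->.
by rewrite mulmx0.
Qed.

(** In an eigenbasis of [S] the hypothesis says that [d_i^2 - d_j^2] annihilates the entry [Q i j].
    The factor [d_i + d_j] vanishes only if both eigenvalues do, so [d_i - d_j] annihilates it
    too. *)
Lemma psd_root_commutes n (S P : 'M[C]_n) :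
  psd S -> S *m S *m P = P *m (S *m S) -> S *m P = P *m S.
Proof.
move=> /psd_spectral [U [d [U1 U2 d0 ->]]].
set D := diag_mx d.
have [Q PE] : exists Q : 'M[C]_n, P = adj U *m Q *m U.
  by exists (U *m P *m adj U); rewrite !mulmxA U1 mul1mx -mulmxA U1 mulmx1.
have conjE (X Y : 'M[C]_n) :
    adj U *m X *m U *m (adj U *m Y *m U) = adj U *m (X *m Y) *m U.
  by rewrite !mulmxA -[_ *m U *m adj U]mulmxA U2 mulmx1.
rewrite PE !conjE => /(congr1 (fun X => U *m X *m adj U)).
rewrite !mulmxA U2 !mul1mx -!(mulmxA _ U) U2 !mulmx1 => DQ.
congr (_ *m _); rewrite -!mulmxA; congr (_ *m _).
apply/matrixP => i j; have /matrixP /(_ i j) := DQ.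
rewrite -[D *m D *m Q]mulmxA /D !mul_diag_mx !mul_mx_diag !mxE => /eqP.
rewrite -subr_eq0 (_ : _ - _ = (d 0 i + d 0 j) * (d 0 i * Q i j - Q i j * d 0 j));
  last by ring.
rewrite mulf_eq0 subr_eq0 => /orP [|/eqP //].
rewrite paddr_eq0 // => /andP [/eqP -> /eqP ->].
by rewrite mul0r mulr0.
Qed.

(** A zero row makes [Y] singular; [v] is a normalised element of the left kernel of [adj Y]. *)
Lemma unit_row_orthogonal n (Y : 'M[C]_n) i0 : row i0 Y = 0 ->
  exists2 v : 'rV[C]_n, v *m adj v = 1%:M & Y *m adj v = 0.
Proof.
move=> Yi0; pose K := kermx (adj Y).
have K0 : K != 0.
  rewrite kermx_eq0 row_free_unit; apply/negP => Yu.
  have : adj Y *m delta_mx i0 0 = 0 :> 'cV[C]_n.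
    by rewrite -[adj Y *m _]adjK adjM adjK (_ : adj (delta_mx _ _) = delta_mx 0 i0);
      [rewrite -rowE Yi0 adj0 | apply/matrixP => i j; rewrite adjE !mxE andbC;
       case: (_ && _); rewrite ?conjC1 ?conjC0].
  move=> /(congr1 (mulmx (invmx (adj Y)))); rewrite mulKmx // mulmx0.
  move=> /matrixP /(_ i0 0) /eqP; rewrite !mxE !eqxx oner_eq0.
  by [].
pose w := nz_row K; pose c := \tr (w *m adj w).
have c0 : 0 < c.
  rewrite lt_def trace_mul_adj_ge0 andbT; apply: contraNneq K0.
  by move=> /trace_mul_adj_eq0 /eqP; rewrite nz_row_eq0.
have wY : w *m adj Y = 0 by apply/sub_kermxP/nz_row_sub.
have sc : (sqrtC c)^-1 ^* = (sqrtC c)^-1.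
  by apply: conj_Creal; rewrite rpredV ger0_real // sqrtC_ge0 ltW.
exists ((sqrtC c)^-1 *: w).
  rewrite adj_scale sc -scalemxAl -scalemxAr scalerA -invfM -expr2 sqrtCK.
  apply/matrixP => i j; rewrite !ord1 [RHS]mxE [LHS]mxE -trace_mx11 -/c.
  by rewrite mulVf // gt_eqF.
by rewrite adj_scale -scalemxAr -(adjK Y) -adjM wY adj0 scaler0.
Qed.

(** Induction on the number of rows outside [e]: after zeroing them, a unit vector orthogonal to all
    rows in [e] exists and fills one more row. *)
Lemma unitary_completion n (Y : 'M[C]_n) (e : pred 'I_n) :
  (forall i j, e i -> e j -> (Y *m adj Y) i j = (i == j)%:R) ->
  exists2 W : 'M[C]_n, W *m adj W = 1%:M & forall i, e i -> row i W = row i Y.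
Proof.
have [k] := ubnP #|[pred i | ~~ e i]|; elim: k Y e => // k IHk Y e.
rewrite ltnS => card_e Yon.
case: (pickP [pred i | ~~ e i]) => [i0 /= ei0|e_all]; last first.
  exists Y => //; apply/matrixP => i j; rewrite Yon ?mxE //.
    by have /negbFE := e_all i.
  by have /negbFE := e_all j.
pose Y0 := \matrix_(i, j) (if e i then Y i j else 0) : 'M[C]_n.
have [v vv Y0v] : exists2 v : 'rV[C]_n, v *m adj v = 1%:M & Y0 *m adj v = 0.
  apply: (@unit_row_orthogonal _ _ i0); apply/rowP => j.
  by rewrite !mxE (negbTE ei0).
pose Y1 := \matrix_(i, j) (if e i then Y i j else v 0 j) : 'M[C]_n.
have Yv i : e i -> (row i Y *m adj v) = 0.
  move=> ei; have /matrixP Y0v' := Y0v; apply/matrixP => a b.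
  transitivity ((Y0 *m adj v) i b); last by rewrite Y0v' !mxE.
  rewrite !mxE; apply: eq_bigr => l _.
  by rewrite !mxE ei.
pose e1 := predU1 i0 e.
have rowY1 i : row i Y1 = if e i then row i Y else v.
  by apply/rowP => j; rewrite !mxE; case: (e i); rewrite ?mxE.
have dotE (Z : 'M[C]_n) i j : (Z *m adj Z) i j = (row i Z *m adj (row j Z)) 0 0.
  by rewrite !mxE; apply: eq_bigr => l _; rewrite !mxE.
have [||W W1 WY] := IHk Y1 e1.
- apply: leq_trans card_e; apply: proper_card; apply/properP; split.
    by apply/subsetP => i; rewrite !inE negb_or => /andP [].
  by exists i0; rewrite !inE // eqxx.
- move=> i j; rewrite !inE dotE !rowY1 => ei ej.
  case ei': (e i); case ej': (e j).
  + by rewrite -dotE Yon.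
  + rewrite (Yv i ei') mxE; case: eqP => // ij; by rewrite ij ej' in ei'.
  + rewrite -[v]adjK -adjM Yv // adj0 mxE; case: eqP => // ij.
    by rewrite ij ej' in ei'.
  + move: ei ej; rewrite ei' ej' !orbF => /eqP -> /eqP ->.
    by rewrite vv mxE !eqxx.
exists W => // i ei; rewrite WY ?inE ?ei ?orbT // rowY1 ei.
by [].
Qed.

(** In an eigenbasis of [B] the columns of [G] are orthogonal with norms the eigenvalues. The
    nonzero ones are normalised and completed to a unitary; this also covers singular [B], since
    columns for the eigenvalue zero vanish. *)
Lemma polar_decomposition n (G B : 'M[C]_n) :
  psd B -> B *m B = adj G *m G ->
  exists2 V : 'M[C]_n, adj V *m V = 1%:M & G = V *m B.
Proof.
move=> /psd_spectral [U [d [U1 U2 d0 ->]]].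
set D := diag_mx d => BB.
have [H Hdef] : exists H, H = G *m adj U by exists (G *m adj U).
have HH : adj H *m H = D *m D.
  rewrite Hdef adjM adjK !mulmxA -[U *m _ *m G]mulmxA -BB !mulmxA U2 mul1mx.
  by rewrite -!mulmxA U2 mulmx1 !mulmxA -[_ *m U *m _]mulmxA U2 mulmx1.
have HHE i j : (adj H *m H) i j = d 0 i ^+ 2 *+ (i == j).
  by rewrite HH mulmx_diag !mxE expr2.
pose Y := \matrix_(i, j) ((d 0 i)^-1 * adj H i j) : 'M[C]_n.
have [|W W1 WY] := @unitary_completion _ Y (fun i => d 0 i != 0).
  move=> i j di dj; rewrite mxE.
  transitivity ((d 0 i)^-1 * (adj H *m H) i j * (d 0 j)^-1).
    rewrite mxE mulr_sumr mulr_suml; apply: eq_bigr => l _; rewrite !mxE.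
    rewrite rmorphM fmorphV /= conjCK (CrealP (ger0_real (d0 j))).
    by rewrite -!mulrA; congr (_ * (_ * _)); rewrite mulrC.
  rewrite HHE; case: eqP => [<-|_]; last by rewrite mulr0n mulr0 mul0r.
  by rewrite mulr1n expr2 mulKf ?divff.
have adjHE : adj H = D *m W.
  apply/row_matrixP => i; rewrite /D mul_diag_mx; apply/rowP => j.
  rewrite !mxE; have [di|di] := eqVneq (d 0 i) 0; last first.
    have /rowP /(_ j) := WY i di; rewrite !mxE => ->.
    by rewrite mulVKf.
  have := HHE i i; rewrite di expr0n mul0rn mxE => /eqP.
  rewrite mul0r psumr_eq0 => [/allP /(_ j)|l _].
    by rewrite mem_index_enum !mxE => /(_ isT); rewrite mulf_eq0 conjC_eq0 orbb =>
      /eqP ->; rewrite conjC0.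
  by rewrite !mxE mulrC mul_conjC_ge0.
exists (adj W *m U).
  by rewrite adjM adjK mulmxA -(mulmxA _ W) W1 mulmx1.
have HE : H = adj W *m D by rewrite -(adjK H) adjHE adjM adj_diag.
by rewrite !mulmxA -[_ *m U *m adj U]mulmxA U2 mulmx1 -HE Hdef -mulmxA U1 mulmx1.
Qed.

(** Cauchy-Schwarz for [U *m S] and [S], with [S] the root of [B]. *)
Lemma norm_trace_unitary_psd n (U B : 'M[C]_n) :
  adj U *m U = 1%:M -> psd B -> `|\tr (U *m B)| <= \tr B.
Proof.
move=> U1 pB; have [[hS _] SS] := sqrtm_spec pB; set S := sqrtm B in hS SS.
have trB := psd_trace_ge0 pB; rewrite -(@ler_pXn2r _ 2) ?nnegrE //.
have := trace_cauchy_schwarz (U *m S) S.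
have -> : U *m S *m S = U *m B by rewrite -mulmxA SS.
have -> : \tr (U *m S *m adj (U *m S)) = \tr B.
  rewrite adjM hS mulmxA -(mulmxA U) SS mxtrace_mulC mulmxA U1.
  by rewrite mul1mx.
by rewrite hS SS expr2.
Qed.

(** Stands in for a limit: if [a] were positive, the choice [e = a / (a + |b|)] would give
    [a^2 <= 0]. *)
Lemma le0_of_le_small_multiples (a b : C) :
  a \is Num.real -> b \is Num.real ->
  (forall e, 0 < e -> e <= 1 -> a <= e * b) -> a <= 0.
Proof.
move=> aR bR h; case: (real_leP aR (rpred0 _)) => // a0.
have ab0 : 0 < a + `|b| by rewrite ltr_wpDr.
have /h : 0 < a / (a + `|b|) by rewrite divr_gt0.
rewrite ler_pdivrMr // mul1r lerDl normr_ge0 => /(_ isT).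
rewrite mulrAC ler_pdivlMr // mulrDr => h'.
have /(le_trans h') : a * b <= a * `|b| by rewrite ler_pM2l // real_ler_norm.
by rewrite gerDr lt_geF // mulr_gt0.
Qed.

End MatrixAnalysis.

(** * Fidelity and von Neumann measurements *)

Section BlockProjections.
Variables (C : numClosedFieldType) (na nb : nat).

(* <i| (x) I^b *)
Definition blockA (i : 'I_na) : 'M[C]_(nb, na * nb) :=
  \matrix_(j, k) (k == mxvec_index i j)%:R.

Lemma eq_mxvec_index (i i' : 'I_na) (j j' : 'I_nb) :
  (mxvec_index i j == mxvec_index i' j') = (i == i') && (j == j').
Proof.
apply/eqP/andP => [h|[/eqP -> /eqP ->] //].
have [g gK _] := curry_mxvec_bij na nb.
have := congr1 g h; rewrite -[mxvec_index i j]/(uncurry (@mxvec_index na nb) (i, j)).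
rewrite -[mxvec_index i' j']/(uncurry (@mxvec_index na nb) (i', j')) !gK //.
by case=> -> ->.
Qed.

Lemma blockA_mul_adj i i' :
  blockA i *m adj (blockA i') = if i == i' then 1%:M else 0.
Proof.
apply/matrixP => j j'; rewrite mxE (bigD1 (mxvec_index i j)) //= !mxE eqxx mul1r.
rewrite eq_mxvec_index big1 => [|k kij]; last by rewrite !mxE (negbTE kij) mul0r.
rewrite addr0 conjC_nat; case: (i == i'); rewrite ?mxE //.
Qed.

Lemma adj_blockA_mul i : adj (blockA i) *m blockA i = projA i.
Proof.
rewrite /projA; apply/matrixP => k l; rewrite mxE summxE; apply: eq_bigr => j _.
by rewrite !mxE conjC_nat -natrM mulnb.
Qed.

Lemma projA_adj i : adj (projA i : 'M[C]_(na * nb)) = projA i.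
Proof. by rewrite -adj_blockA_mul adjM adjK. Qed.

Lemma projA_mul i j :
  projA i *m projA j = if i == j then projA i else 0 :> 'M[C]_(na * nb).
Proof.
rewrite -!adj_blockA_mul mulmxA -(mulmxA _ (blockA i)) blockA_mul_adj.
by case: eqP => [->|_]; rewrite ?mulmx1 // mulmx0 mul0mx.
Qed.

Lemma projA_sum : \sum_i projA i = 1%:M :> 'M[C]_(na * nb).
Proof.
rewrite /projA pair_big mx1_sum_delta.
rewrite (reindex (uncurry (@mxvec_index na nb))) /=; last exact: curry_mxvec_bij.
by apply: eq_bigr => -[].
Qed.

Lemma projA_psd i : psd (projA i : 'M[C]_(na * nb)).
Proof. by rewrite -adj_blockA_mul; apply: psd_gram. Qed.

Lemma projA_sumK p (X : 'M[C]_(na * nb, p)) : \sum_i projA i *m X = X.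
Proof. by rewrite -mulmx_suml projA_sum mul1mx. Qed.

Lemma vN_conj_projA (U : 'M[C]_(na * nb)) : adj U *m U = 1%:M ->
  is_vN (fun i => adj U *m projA i *m U).
Proof.
move=> U1; have U2 := mulmx1C U1.
have mulE i j : adj U *m projA i *m U *m (adj U *m projA j *m U) =
    adj U *m (projA i *m projA j) *m U.
  by rewrite !mulmxA -[_ *m U *m adj U]mulmxA U2 mulmx1.
split=> [i|]; first by rewrite /Defs.hermitian !adjM adjK projA_adj mulmxA.
split=> [i|]; first by rewrite mulE projA_mul eqxx.
split=> [i j ij|]; first by rewrite mulE projA_mul (negbTE ij) mulmx0 mul0mx.
by rewrite -mulmx_suml -mulmx_sumr projA_sum mulmx1.
Qed.

Lemma vN_POVM (P : 'I_na -> 'M[C]_(na * nb)) : is_vN P -> is_POVM P.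
Proof.
move=> [hP [PP [_ sumP]]]; split=> // i.
by rewrite -PP -{1}hP; apply: psd_gram.
Qed.

Lemma dephase_incoherent (Q : 'I_na -> 'M[C]_(na * nb)) :
  let A := \sum_i projA i *m Q i *m projA i in
  \sum_i projA i *m A *m projA i = A.
Proof.
move=> A; rewrite {2}/A; apply: eq_bigr => i _; rewrite /A mulmx_sumr mulmx_suml.
rewrite (bigD1 i) //= big1 => [|j ji]; last first.
  by rewrite !mulmxA projA_mul eq_sym (negbTE ji) !mul0mx.
by rewrite addr0 !mulmxA projA_mul eqxx -(mulmxA _ (projA i)) projA_mul eqxx.
Qed.

End BlockProjections.

(** * Fidelity with partial incoherent states *)

Section Fidelity.
Variables (C : numClosedFieldType) (na nb : nat).
Local Notation N := (na * nb)%N.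
Local Notation Pi := (@projA C na nb).
Variable rho : 'M[C]_N.
Hypothesis rho_state : is_state rho.
Local Notation s := (sqrtm rho).

(** The unnormalised states [eta_i omega_i], for which no division by [eta_i] occurs. *)
Definition weighted i : 'M[C]_N := s *m Pi i *m s.

Let s_psd : psd s. Proof. by have [] := sqrtm_spec rho_state.1. Qed.
Let s_adj : adj s = s. Proof. exact: s_psd.1. Qed.
Let ss : s *m s = rho. Proof. by have [] := sqrtm_spec rho_state.1. Qed.

Lemma weighted_psd i : psd (weighted i).
Proof. by have := psd_conj s (projA_psd C nb i); rewrite s_adj. Qed.

Lemma ens_etaE i : ens_eta rho i = \tr (weighted i).
Proof. by rewrite /ens_eta /weighted [RHS]mxtrace_mulC mulmxA ss mxtrace_mulC. Qed.

(** If [eta_i = 0], the weighted state is positive semidefinite of trace zero, so it agrees with the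
    default value of [ens_omega]. *)
Lemma ens_eta_omega i : ens_eta rho i *: ens_omega rho i = weighted i.
Proof.
rewrite /ens_omega; case: eqP => [eta0|/eqP eta0].
  by rewrite scaler0; apply/esym/psd_trace_eq0; rewrite -?ens_etaE //;
    apply: weighted_psd.
by rewrite scalerA divff // scale1r.
Qed.

Lemma ens_successE M : success (ens_eta rho) (ens_omega rho) M =
  \sum_i \tr (M i *m weighted i).
Proof.
apply: eq_bigr => i _.
by rewrite -ens_eta_omega -scalemxAr mxtraceZ.
Qed.

(** The fidelity is the trace of the absolute value of [s *m sqrtm sigma], the form that polar
    decomposition needs. *)
Lemma fidelity_root sigma : psd sigma -> exists2 B : 'M[C]_N,
  psd B /\ B *m B = adj (s *m sqrtm sigma) *m (s *m sqrtm sigma) &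
  fidelity rho sigma = \tr B.
Proof.
move=> /sqrtm_spec [[hS _] _]; set S := sqrtm sigma in hS *.
have SE : S *m rho *m S = adj (s *m S) *m (s *m S).
  by rewrite adjM hS s_adj mulmxA -(mulmxA S s) ss.
exists (sqrtm (S *m rho *m S)) => //.
by have := sqrtm_spec (psd_gram (s *m S)); rewrite SE.
Qed.

Lemma fidelity_ge0 sigma : psd sigma -> 0 <= fidelity rho sigma.
Proof. by move=> /fidelity_root [B [pB _] ->]; apply: psd_trace_ge0. Qed.

Lemma partial_incoherent_commutes sigma i :
  partial_incoherent sigma -> sigma *m Pi i = Pi i *m sigma.
Proof.
move=> [_ sE]; rewrite -{1 2}sE mulmx_suml mulmx_sumr; apply: eq_bigr => j _.
rewrite !mulmxA -mulmxA !projA_mul eq_sym.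
by case: eqP => [->|_] //; rewrite !mul0mx mulmx0.
Qed.

Lemma fidelity_le_rotated_projections sigma : partial_incoherent sigma ->
  exists2 U : 'M[C]_N, adj U *m U = 1%:M &
    fidelity rho sigma ^+ 2 <= \sum_i \tr (Pi i *m U *m weighted i *m adj U).
Proof.
move=> incoh; have [[p_sigma tr_sigma] _] := incoh.
have [[hS pS] SS] := sqrtm_spec p_sigma.
have [B [pB BB] FB] := fidelity_root p_sigma.
have F0 := fidelity_ge0 p_sigma.
have [V V1 GE] := polar_decomposition pB BB.
set S := sqrtm sigma in hS pS SS GE.
have SPi i : S *m Pi i = Pi i *m S.
  by apply: psd_root_commutes; rewrite ?SS //; apply: partial_incoherent_commutes.
pose U := adj V; have U1 : adj U *m U = 1%:M by rewrite adjK; apply: mulmx1C.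
(* Since [S] commutes with the projections, only the block part [T] of [U *m s] contributes to the
   trace against [S]. Cauchy-Schwarz for [T] and [S] then yields the score, because [S] has norm
   one. *)
exists U => //; pose T := \sum_i Pi i *m U *m s *m Pi i.
have FE : fidelity rho sigma = \tr (T *m S).
  rewrite FB -[B]mul1mx -V1 -mulmxA -GE -/U mulmxA.
  rewrite mulmx_suml raddf_sum /= -[U *m s *m S]projA_sumK raddf_sum /=.
  apply: eq_bigr => i _; rewrite -(mulmxA _ (Pi i) S) -SPi !mulmxA.
  rewrite [RHS]mxtrace_mulC !mulmxA projA_mul eqxx.
  by [].
rewrite -[fidelity _ _]ger0_norm // FE.
apply: le_trans (trace_cauchy_schwarz T S) _.
rewrite hS SS tr_sigma mulr1 /T adj_sum mulmx_suml raddf_sum /=.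
rewrite le_eqVlt; apply/orP; left; apply/eqP; apply: eq_bigr => i _.
rewrite mulmx_sumr (bigD1 i) //= big1 => [|j ji]; last first.
  rewrite !adjM projA_adj !mulmxA -(mulmxA _ (Pi i)) projA_mul eq_sym (negbTE ji).
  by rewrite mulmx0 !mul0mx.
rewrite addr0 !adjM projA_adj s_adj !mulmxA mxtrace_mulC !mulmxA projA_mul eqxx.
by rewrite -(mulmxA _ (Pi i) (Pi i)) projA_mul eqxx.
Qed.

Lemma partial_incoherent_exists : exists sigma : 'M[C]_N, partial_incoherent sigma.
Proof.
have [p_rho tr_rho] := rho_state.
exists (\sum_i Pi i *m rho *m Pi i); split; last exact: dephase_incoherent.
split.
  apply: psd_sum => i; rewrite -{1}projA_adj; exact: psd_conj.
rewrite raddf_sum /= -tr_rho -{2}[rho]projA_sumK raddf_sum /=.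
by apply: eq_bigr => i _; rewrite mxtrace_mulC mulmxA projA_mul eqxx.
Qed.

Lemma vN_success_le_fidelity (P : 'I_na -> 'M[C]_N) : is_vN P ->
  exists2 sigma, partial_incoherent sigma &
    \sum_i \tr (P i *m weighted i) <= fidelity rho sigma ^+ 2.
Proof.
move=> vN; have [pP _] := vN_POVM vN; have [hP [PP [PP0 sumP]]] := vN.
set w := \sum_i _.
have w0 : 0 <= w.
  by apply: sumr_ge0 => i _; case: (psd_trace_mul (pP i) (weighted_psd i)).
(* For [w = 0] the Gram matrix cannot be normalised, but any incoherent state will do. *)
have [w_eq0|w_neq0] := eqVneq w 0.
  have [sigma incoh] := partial_incoherent_exists; exists sigma => //.
  by rewrite w_eq0 exprn_ge0 // fidelity_ge0 //; case: incoh => -[].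
pose B := \sum_i P i *m s *m Pi i; pose Q := adj B *m B.
have QE : Q = \sum_i Pi i *m (s *m P i *m s) *m Pi i.
  rewrite /Q /B adj_sum mulmx_suml; apply: eq_bigr => i _.
  rewrite mulmx_sumr (bigD1 i) //= big1 => [|j ji]; last first.
    rewrite !adjM hP !mulmxA -(mulmxA _ (P i)) PP0 1?eq_sym //.
    by rewrite mulmx0 !mul0mx.
  by rewrite addr0 !adjM hP s_adj projA_adj !mulmxA -(mulmxA _ (P i) (P i)) PP.
have trE i : \tr (Pi i *m (s *m P i *m s)) = \tr (P i *m weighted i).
  by rewrite /weighted mxtrace_mulC -!mulmxA mxtrace_mulC !mulmxA.
have trQ : \tr Q = w.
  rewrite QE raddf_sum /=; apply: eq_bigr => i _.
  by rewrite -trE mxtrace_mulC !mulmxA projA_mul eqxx.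
have wV0 : 0 <= w^-1 by rewrite invr_ge0.
pose sigma := w^-1 *: Q.
have incoh : partial_incoherent sigma.
  split; first by split; [apply/psdZ/psd_gram | rewrite mxtraceZ trQ mulVf].
  have QK : \sum_i Pi i *m Q *m Pi i = Q by rewrite QE; apply: dephase_incoherent.
  rewrite /sigma -[in RHS]QK scaler_sumr.
  by apply: eq_bigr => i _; rewrite -scalemxAr -scalemxAl.
exists sigma => //; have [[p_sigma _] _] := incoh.
have [pR RR] := sqrtm_spec p_sigma; set R := sqrtm sigma in pR RR.
have [B' [pB' BB'] FB] := fidelity_root p_sigma; rewrite -/R in BB'.
have [W W1 GE] := polar_decomposition pB' BB'.
pose q := sqrtC w; have q0 : 0 <= q by rewrite sqrtC_ge0.
have qq : q * q = w by rewrite -expr2 sqrtCK.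
(* The absolute value of [B] is [q *: R], because [B] has Gram matrix [w *: sigma]. *)
have [|V V1 BE] := @polar_decomposition _ _ B (q *: R) (psdZ q0 pR).
  by rewrite -scalemxAl -scalemxAr scalerA qq RR scalerA divff // scale1r.
have q_neq0 : q != 0 by rewrite sqrtC_eq0.
(* Multiplied by [q], the left side becomes the trace of [adj B *m s], which is [w = q * q]. *)
have trVG : \tr (adj V *m (s *m R)) = q.
  apply: (mulfI q_neq0); rewrite qq -mxtraceZ !scalemxAr mulmxA mxtrace_mulC mulmxA.
  have -> : (q *: R) *m adj V = adj B.
    by rewrite BE adjM [adj (q *: R)](psdZ q0 pR).1.
  rewrite /B adj_sum mulmx_suml raddf_sum /=; apply: eq_bigr => i _.
  by rewrite -trE !adjM hP s_adj projA_adj !mulmxA.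
have q_le : q <= fidelity rho sigma.
  rewrite FB -(ger0_norm q0) -trVG GE mulmxA norm_trace_unitary_psd //.
  by rewrite adjM adjK mulmxA -(mulmxA _ V) (mulmx1C V1) mulmx1.
by rewrite -qq -expr2 ler_pXn2r ?nnegrE // FB psd_trace_ge0.
Qed.

End Fidelity.

(** * Optimal measurements *)

Section Discrimination.
Variables (C : numClosedFieldType) (na nb : nat).
Local Notation N := (na * nb)%N.
Variable X : 'I_na -> 'M[C]_N.
Hypothesis psdX : forall i, psd (X i).
Local Notation score M := (\sum_i \tr (M i *m X i)).

Let hX i : adj (X i) = X i. Proof. exact: (psdX i).1. Qed.

Lemma score_real M : (forall i, psd (M i)) -> score M \is Num.real.
Proof.
move=> pM; apply: ger0_real; apply: sumr_ge0 => i _.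
by case: (psd_trace_mul (pM i) (psdX i)).
Qed.

(** Conjugating every element by [1 - e P] leaves the deficit [1 - (1 - e P)^2 = e (2 - e) P], which
    is given to outcome [j]. *)
Lemma projector_update_POVM M (P : 'M[C]_N) e j :
  is_POVM M -> adj P = P -> P *m P = P -> 0 < e -> e <= 1 ->
  is_POVM (fun i => (1%:M - e *: P) *m M i *m (1%:M - e *: P) +
    (if i == j then (e * (2 - e)) *: P else 0)).
Proof.
move=> [pM sumM] hP PP e0 e1.
have hT : adj (1%:M - e *: P) = 1%:M - e *: P.
  by rewrite adjB adj_id adj_scale hP conj_Creal // gtr0_real.
have pP : psd P by rewrite -PP -{1}hP; apply: psd_gram.
have c0 : 0 <= e * (2 - e).
  by rewrite mulr_ge0 ?ltW // subr_gt0 (le_lt_trans e1) // ltr1n.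
split=> [i|].
  apply: psd_add; first by rewrite -{1}hT; apply: psd_conj.
  case: eqP => _; first exact: psdZ.
  by have := psd_gram (0 : 'M[C]_N); rewrite mulmx0.
rewrite big_split /= -mulmx_suml -mulmx_sumr sumM mulmx1 -big_mkcond big_pred1_eq.
rewrite mulmxBl !mulmxBr !mulmx1 mul1mx -scalemxAl -scalemxAr PP scalerA.
apply/matrixP => k l; rewrite !mxE; ring.
Qed.

(* Perturbing [M] along a rank-one projector is the infinitesimal form of the
   duality for this semidefinite program: [K] is the dual optimum. *)
Lemma optimal_POVM_dual M :
  is_POVM M -> (forall M', is_POVM M' -> score M' <= score M) ->
  exists K : 'M[C]_N, adj K = K /\
    forall j, psd (K - X j) /\ M j *m K = M j *m X j.
Proof.
move=> POVM_M maxM; have [pM sumM] := POVM_M.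
pose K0 := \sum_i M i *m X i; pose K := 2^-1 *: (K0 + adj K0).
have half : (2^-1 : C)^* = 2^-1.
  by apply: conj_Creal; rewrite rpredV realn.
have hK : adj K = K by rewrite adj_scale adjD adjK half addrC.
have pK j : psd (K - X j).
  split=> [|v]; first by rewrite /Defs.hermitian adjB hK hX.
  have -> : (adj v *m (K - X j) *m v) 0 0 = \tr ((K - X j) *m (v *m adj v)).
    by rewrite -trace_mx11 -mulmxA mxtrace_mulC mulmxA.
  pose c := \tr (v *m adj v); have c_ge0 : 0 <= c by apply: trace_mul_adj_ge0.
  have [c0|c0] := eqVneq c 0.
    by rewrite (trace_mul_adj_eq0 c0) mul0mx mulmx0 mxtrace0.
  have cE : adj v *m v = c%:M.
    by rewrite [LHS]mx11_scalar -trace_mx11 mxtrace_mulC.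
  (* Positivity at [v] is tested through the projector onto the line of [v]. *)
  have [P [hP PP ->]] : exists P : 'M[C]_N,
      [/\ adj P = P, P *m P = P & v *m adj v = c *: P].
    have cVR : (c^-1)^* = c^-1 by apply: conj_Creal; rewrite rpredV ger0_real.
    exists (c^-1 *: (v *m adj v)); split; last by rewrite scalerA divff // scale1r.
      by rewrite adj_scale adjM adjK cVR.
    rewrite -scalemxAl -scalemxAr mulmxA -(mulmxA v) cE mul_mx_scalar.
    by rewrite -scalemxAl !scalerA mulVf // mulr1.
  have pP : psd P by rewrite -PP -{1}hP; apply: psd_gram.
  rewrite -scalemxAr mxtraceZ mulr_ge0 // mxtrace_mulC mulmxBr raddfB /= subr_ge0.
  pose q := \sum_i \tr (P *m M i *m P *m X i).
  have qR : q \is Num.real.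
    apply: ger0_real; apply: sumr_ge0 => i _; rewrite -{1}hP.
    by case: (psd_trace_mul (psd_conj P (pM i)) (psdX i)).
  have xR : \tr (P *m X j) \is Num.real.
    by apply: ger0_real; case: (psd_trace_mul pP (psdX j)).
  have kR : \tr (P *m K) \is Num.real.
    by apply/CrealP; rewrite -trace_adj adjM hP hK mxtrace_mulC.
  (* Optimality against the perturbed measurement reads [2 (tr(P X_j) - tr(P K)) <= e (tr(P X_j) -
     q)] for [0 < e <= 1]. *)
  rewrite -subr_le0 -(@pmulr_rle0 _ 2) ?ltr0n //.
  apply: (@le0_of_le_small_multiples _ _ (\tr (P *m X j) - q)).
  - by rewrite rpredM ?rpredB ?realn.
  - by rewrite rpredB.
  move=> e e0 e1; have /= := maxM _ (projector_update_POVM j POVM_M hP PP e0 e1).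
  have k2 : 2 * \tr (P *m K) =
      \sum_i (\tr (P *m M i *m X i) + \tr (M i *m P *m X i)).
    rewrite -scalemxAr mxtraceZ mulrA divff ?pnatr_eq0 // mul1r mulmxDr raddfD.
    rewrite big_split /= adj_sum !mulmx_sumr !raddf_sum; congr (_ + _).
      by apply: eq_bigr => i _; rewrite mulmxA.
    apply: eq_bigr => i _; rewrite /= adjM hX (pM i).1 mulmxA.
    by rewrite [LHS]mxtrace_mulC mulmxA.
  have sumE : \sum_i (if i == j then e * (2 - e) * \tr (P *m X j) else 0) =
      e * (2 - e) * \tr (P *m X j) by rewrite -big_mkcond big_pred1_eq.
  have -> : \sum_i \tr (((1%:M - e *: P) *m M i *m (1%:M - e *: P) +
      (if i == j then (e * (2 - e)) *: P else 0)) *m X i) =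
    score M - e * (2 * \tr (P *m K)) + e ^+ 2 * q + e * (2 - e) * \tr (P *m X j).
    rewrite -sumE k2 /q [e * \sum_(_ < na) _]mulr_sumr [e ^+ 2 * \sum_(_ < na) _]mulr_sumr.
    rewrite -sumrB -!big_split; apply: eq_bigr => i _ /=.
    rewrite mulmxDl raddfD /=; congr (_ + _); last first.
      case: eqP => [->|_]; last by rewrite mul0mx mxtrace0.
      by rewrite -scalemxAl mxtraceZ.
    rewrite !(mulmxBl, mulmxBr, mul1mx, mulmx1) -!(scalemxAl, scalemxAr).
    rewrite !(raddfB, mxtraceZ) /=.
    rewrite !mxtraceZ; ring.
  rewrite -subr_ge0 => h; rewrite -subr_ge0 -(@pmulr_rge0 _ e) //.
  apply: le_trans h _; rewrite le_eqVlt; apply/orP; left; apply/eqP.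
  ring.
have trK : \tr K = score M.
  have trK0 : \tr K0 = score M by rewrite raddf_sum.
  rewrite mxtraceZ mxtraceD trace_adj trK0 (CrealP (score_real pM)).
  by rewrite -mulr2n -[X in _ * X]mulr_natl mulrA mulVf ?pnatr_eq0 // mul1r.
exists K; split=> // j; split=> //.
(* Complementary slackness: the nonnegative traces of [M j *m (K - X j)] sum to [tr K] minus the
   score, which is zero. *)
apply/eqP; rewrite -subr_eq0 -mulmxBr; apply/eqP.
have [_ ->] // := psd_trace_mul (pM j) (pK j).
have : \sum_j \tr (M j *m (K - X j)) == 0.
  under eq_bigr do rewrite mulmxBr raddfB /=.
  by rewrite sumrB -trK -raddf_sum -mulmx_suml sumM mul1mx subrr.
rewrite psumr_eq0 => [/allP /(_ j)|i _]; last by case: (psd_trace_mul (pM i) (pK i)).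
by rewrite mem_index_enum => /(_ isT) /eqP.
Qed.

(* Compressed by [A], the optimality conditions read [H *m G j = D j *m G j];
   they make the compressed measurement operators orthogonal. *)
Lemma optimal_POVM_projective r (A : 'M[C]_(N, r)) (L : 'M[C]_(r, N))
    (D : 'I_na -> 'M[C]_r) M :
  L *m A = 1%:M -> (forall i, adj (D i) = D i) ->
  (forall i j, D i *m D j = if i == j then D i else 0) -> \sum_i D i = 1%:M ->
  (forall i, X i = A *m D i *m adj A) -> (0 < na)%N ->
  is_POVM M -> (forall M', is_POVM M' -> score M' <= score M) ->
  exists2 P, is_vN P & score P = score M.
Proof.
move=> LA hD DD sumD XE na0 POVM_M maxM; have [pM sumM] := POVM_M.
have [K [hK Kopt]] := optimal_POVM_dual POVM_M maxM.
have AL : adj A *m adj L = 1%:M by rewrite -adjM LA adj_id.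
have MK j : M j *m K = M j *m X j by have [] := Kopt j.
have hM j : adj (M j) = M j := (pM j).1.
have [H Hdef] : exists H, H = L *m K *m adj L by eexists.
(* [K] is the sum of the [M j *m X j], so it absorbs [adj L *m adj A] on the right and, being
   hermitian, [A *m L] on the left. *)
have KE : K = A *m H *m adj A.
  have KAL : K = K *m (adj L *m adj A).
    rewrite -{1}[K]mul1mx -{2}[K]mul1mx -sumM !mulmx_suml; apply: eq_bigr => j _.
    by rewrite MK XE !mulmxA -(mulmxA _ (adj A) (adj L)) AL mulmx1.
  have ALK : K = A *m L *m K.
    by have := congr1 (@adj C N N) KAL; rewrite !adjM !adjK hK.
  by rewrite {1}ALK {1}KAL Hdef !mulmxA.
have hH : adj H = H by rewrite Hdef !adjM adjK hK mulmxA.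
have [G Gdef] : exists G, forall j, G j = adj A *m M j *m A.
  by exists (fun j => adj A *m M j *m A).
have hG j : adj (G j) = G j by rewrite Gdef !adjM adjK hM mulmxA.
have HG j : H *m G j = D j *m G j.
  have := congr1 (@adj C N N) (MK j); rewrite !adjM hM hK hX KE XE.
  move=> /(congr1 (mulmx L)) /(congr1 (mulmx^~ A)).
  by rewrite !mulmxA LA !mul1mx Gdef !mulmxA.
have GH j : G j *m H = G j *m D j.
  by rewrite -[LHS]adjK adjM hG hH HG adjM hG hD.
(* On a kernel vector [w] of [H], the inequalities [K >= X j] force every [D j *m w] to vanish, and
   the [D j] sum to the identity. *)
have H_unit : H \in unitmx.
  rewrite -row_free_unit; apply: inj_row_free => v vH.
  pose w := adj v; have [u Au] : exists u, adj A *m u = w.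
    by exists (adj L *m w); rewrite mulmxA AL mul1mx.
  have Hw : H *m w = 0 by rewrite -hH -adjM vH adj0.
  have Dw j : D j *m w = 0.
    have [[_ /(_ u) ge0] _] := Kopt j.
    have := ge0; rewrite KE XE mulmxBr mulmxBl.
    have -> : adj u *m (A *m H *m adj A) *m u = 0.
      transitivity (adj w *m (H *m w)); last by rewrite Hw mulmx0.
      by rewrite -Au adjM adjK !mulmxA.
    have -> : adj u *m (A *m D j *m adj A) *m u = adj (D j *m w) *m (D j *m w).
      rewrite adjM hD [RHS]mulmxA -(mulmxA _ (D j) (D j)) DD eqxx.
      by rewrite -Au adjM adjK !mulmxA.
    rewrite sub0r mxE oppr_ge0 -trace_mx11 mxtrace_mulC => le0.
    apply: trace_mul_adj_eq0; apply/le_anti.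
    by rewrite le0 trace_mul_adj_ge0.
  rewrite -[v]adjK -/w -[w]mul1mx -sumD mulmx_suml big1 ?adj0 // => j _.
have [Gr Grdef] : exists Gr, Gr = adj A *m A by eexists.
have [T Tdef] : exists T, T = \sum_k D k *m G k *m D k by eexists.
have sumG : \sum_j G j = Gr.
  rewrite Grdef -[adj A]mulmx1 -sumM mulmx_sumr mulmx_suml.
  by apply: eq_bigr => j _; rewrite Gdef.
(* [T] is block diagonal for the [D k]. Hence the inverse of [Gr] is [H *m invmx T *m H], and [T]
   commutes with each [D k]. *)
have HGH : H *m Gr *m H = T.
  rewrite -sumG Tdef mulmx_sumr mulmx_suml; apply: eq_bigr => j _.
  by rewrite HG -mulmxA GH mulmxA.
have Gr_unit : Gr \in unitmx.
  rewrite -row_free_unit; apply: inj_row_free => v vGr.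
  have : adj (A *m adj v) *m (A *m adj v) = 0.
    by rewrite adjM adjK mulmxA -(mulmxA v) -Grdef vGr mul0mx.
  move=> /(congr1 (@mxtrace C 1)); rewrite mxtrace_mulC mxtrace0.
  move=> /trace_mul_adj_eq0 /(congr1 (mulmx L)); rewrite mulmxA LA mul1mx mulmx0.
  by move=> /(congr1 (@adj C r 1)); rewrite adjK adj0.
pose Gi := invmx Gr.
have T_unit : T \in unitmx by rewrite -HGH !unitmx_mul H_unit Gr_unit.
have GiE : Gi = H *m invmx T *m H.
  have : Gr *m (H *m invmx T *m H) = 1%:M.
    apply: (can_inj (mulKmx H_unit)); rewrite mulmx1 !mulmxA HGH mulmxV //.
    by rewrite mul1mx.
  by move=> /(congr1 (mulmx Gi)); rewrite mulKmx // mulmx1.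
have TD k : T *m D k = D k *m T.
  rewrite Tdef mulmx_suml mulmx_sumr; apply: eq_bigr => i _.
  rewrite -mulmxA !mulmxA -(mulmxA _ (D i) (D k)) !DD eq_sym.
  by case: eqP => [->|_] //; rewrite mulmx0 !mul0mx.
have TiD k : invmx T *m D k = D k *m invmx T.
  apply: (can_inj (mulKmx T_unit)); rewrite mulKVmx // mulmxA TD -mulmxA.
  by rewrite mulmxV // mulmx1.
(* The outer factors [H] turn into [D i] and [D j], which meet across [invmx T] and annihilate each
   other. *)
have G_ortho i j : i != j -> G i *m Gi *m G j = 0.
  move=> ij; rewrite GiE !mulmxA GH -[_ *m H *m G j]mulmxA HG mulmxA.
  rewrite -(mulmxA _ (invmx T)) TiD mulmxA -(mulmxA _ (D i) (D j)) DD (negbTE ij).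
  by rewrite mulmx0 !mul0mx.
have hGi : adj Gi = Gi.
  have hGr : adj Gr = Gr by rewrite Grdef adjM adjK.
  have : adj Gi *m Gr = 1%:M by rewrite -{1}hGr -adjM mulmxV // adj_id.
  by move=> /(congr1 (mulmx^~ Gi)); rewrite mulmxK // mul1mx.
(* [E] is the orthogonal projector onto the range of [A], and [Q j] is [E *m M j *m E]. *)
have [Q Qdef] : exists Q, forall j, Q j = A *m Gi *m G j *m Gi *m adj A.
  by exists (fun j => A *m Gi *m G j *m Gi *m adj A).
have [E Edef] : exists E, E = A *m Gi *m adj A by eexists.
have hQ j : adj (Q j) = Q j by rewrite Qdef !adjM adjK hGi hG !mulmxA.
have sumQ : \sum_j Q j = E.
  transitivity (A *m Gi *m Gr *m Gi *m adj A).
    rewrite -sumG mulmx_sumr !mulmx_suml.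
    by apply: eq_bigr => j _; rewrite Qdef.
  by rewrite -(mulmxA _ Gi Gr) mulVmx // mulmx1 Edef.
have AA p (B : 'M[C]_(p, r)) : B *m adj A *m A = B *m Gr.
  by rewrite Grdef mulmxA.
have QQ0 i j : i != j -> Q i *m Q j = 0.
  move=> ij; rewrite !Qdef !mulmxA AA -(mulmxA _ Gi Gr) mulVmx // mulmx1.
  by rewrite -!mulmxA (mulmxA (G i)) (mulmxA (G i *m Gi)) G_ortho //
    mul0mx !mulmx0.
have EQ j : E *m Q j = Q j.
  by rewrite Edef Qdef !mulmxA AA -(mulmxA _ Gi Gr) mulVmx // mulmx1.
have QQ i : Q i *m Q i = Q i.
  rewrite -{3}[Q i]EQ -sumQ mulmx_suml (bigD1 i) //= big1 ?addr0 // => j ji.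
  exact: QQ0.
have hE : adj E = E by rewrite Edef !adjM adjK hGi mulmxA.
have QE j : Q j *m E = Q j by rewrite -[LHS]adjK adjM hQ hE EQ hQ.
have EE : E *m E = E by rewrite -{2}sumQ mulmx_sumr -[RHS]sumQ; apply: eq_bigr.
have EA : E *m A = A by rewrite Edef AA mulmxKV.
have [F Fdef] : exists F, F = 1%:M - E by eexists.
have hF : adj F = F by rewrite Fdef adjB adj_id hE.
have QF j : Q j *m F = 0 by rewrite Fdef mulmxBr mulmx1 QE subrr.
have FQ j : F *m Q j = 0 by rewrite Fdef mulmxBl mul1mx EQ subrr.
have FF : F *m F = F.
  by rewrite {2}Fdef mulmxBr mulmx1 {2}Fdef mulmxBl mul1mx EE subrr subr0.
pose i0 := Ordinal na0.
(* The complement [F] of the range of [A] goes to one outcome; it leaves the score unchanged because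
   [F *m A = 0]. *)
pose P j := Q j + (if j == i0 then F else 0).
exists P.
  split=> [j|].
    by rewrite /Defs.hermitian /P adjD hQ; case: eqP => _; rewrite ?adj0 ?hF.
  split=> [j|].
    rewrite /P; case: eqP => _; last by rewrite addr0 QQ.
    by rewrite mulmxDr !mulmxDl QQ FQ QF FF addr0 add0r.
  split=> [i j ij|].
    rewrite /P mulmxDr !mulmxDl QQ0 // add0r.
    case: (eqVneq i i0) => [ei|_]; case: (eqVneq j i0) => [ej|_];
      rewrite ?QF ?FQ ?mulmx0 ?mul0mx ?addr0 //.
    by rewrite ei ej eqxx in ij.
  by rewrite big_split /= sumQ -big_mkcond big_pred1_eq Fdef addrC subrK.
apply: eq_bigr => j _; rewrite /P mulmxDl raddfD /=.
rewrite [X in _ + \tr X](_ : _ = 0) ?mxtrace0 ?addr0; last first.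
  case: eqP => _; last by rewrite mul0mx.
  by rewrite Fdef mulmxBl mul1mx XE !mulmxA EA subrr.
rewrite Qdef XE !mulmxA AA -(mulmxA _ Gi Gr) mulVmx // mulmx1.
rewrite mxtrace_mulC !mulmxA -Grdef mulmxV // mul1mx Gdef.
by rewrite [RHS]mxtrace_mulC !mulmxA.
Qed.

End Discrimination.

(** * Existence of optimal measurements and the linearly independent case *)

Section Optimizers.
Variables (C : numClosedFieldType) (na nb : nat).
Local Notation N := (na * nb)%N.
Variable rho : 'M[C]_N.
Hypothesis rho_state : is_state rho.
Local Notation X := (weighted rho).

Lemma na_gt0 : (0 < na)%N.
Proof.
have [_ tr1] := rho_state; rewrite lt0n; apply/negP => /eqP na0.
move: tr1; rewrite /mxtrace big1 => [/eqP|i _]; first by rewrite eq_sym oner_eq0.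
by have := ltn_ord i; rewrite {2}na0.
Qed.

(** The columns of [A] are the vectors [psi i j] scaled by the root of [eta_i lam_ij]. Linear
    independence supplies the left inverse [L], and [D i] selects the columns belonging to [i]. *)
Lemma lin_indep_factorization : lin_indep_states (ens_eta rho) (ens_omega rho) ->
  exists (r : nat) (A : 'M[C]_(N, r)) (L : 'M[C]_(r, N)) (D : 'I_na -> 'M[C]_r),
    [/\ L *m A = 1%:M, forall i, adj (D i) = D i,
      forall i j, D i *m D j = if i == j then D i else 0, \sum_i D i = 1%:M &
      forall i, X i = A *m D i *m adj A].
Proof.
case=> r [lam [psi [r0 [lam0 [_ [omegaE free]]]]]].
pose idx := {i : 'I_na & 'I_(r i)}; pose K := #|{: idx}|.
pose a (x : idx) := sqrtC (ens_eta rho (tag x) * lam (tag x) (tagged x)).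
have eta0 (x : idx) : 0 < ens_eta rho (tag x).
  have [//|/negP/r0 r00] := boolP (0 < ens_eta rho (tag x)).
  by case: x r00 => i j /= r00; have := ltn_ord j; rewrite {2}r00.
have a2 x : a x * a x = ens_eta rho (tag x) * lam (tag x) (tagged x).
  by rewrite -expr2 sqrtCK.
have a0 x : 0 < a x by rewrite sqrtC_gt0 mulr_gt0.
pose A : 'M[C]_(N, K) :=
  \matrix_(k, t) (a (enum_val t) * psi (tag (enum_val t)) (tagged (enum_val t)) k 0).
pose d i : 'rV[C]_K := \row_t (tag (enum_val t : idx) == i)%:R.
pose D i := diag_mx (d i).
have [L LA] : exists L : 'M[C]_(K, N), L *m A = 1%:M.
  suff /row_freeP [B AB] : row_free A^T.
    by exists B^T; rewrite -[A]trmxK -trmx_mul AB trmx1.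
  apply: inj_row_free => v vA; pose c (x : idx) := v 0 (enum_rank x) * a x.
  have cT x : c (Tagged (fun i => 'I_(r i)) (tagged x)) = c x by case: x.
  have := free (fun i j => c (Tagged (fun i => 'I_(r i)) j)).
  have -> : \sum_i \sum_j c (Tagged (fun i => 'I_(r i)) j) *: psi i j = (v *m A^T)^T.
    rewrite (sig_big_dep _ _ (fun i j => c (Tagged (fun i => 'I_(r i)) j) *: psi i j)).
    apply/matrixP => k l; rewrite ord1 summxE !mxE.
    rewrite (reindex (@enum_val idx xpredT)) /=; last first.
      by apply: onW_bij; apply: enum_val_bij.
    by apply: eq_bigr => t _; rewrite !mxE cT /c enum_valK mulrA.
  rewrite vA trmx0 => /(_ erefl) c0; apply/rowP => t; rewrite mxE.
  have := c0 (tag (enum_val t)) (tagged (enum_val t)); rewrite cT /c enum_valK.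
  by move/eqP; rewrite mulf_eq0 [a _ == 0]gt_eqF // orbF => /eqP.
exists K, A, L, D; split=> //.
- by move=> i; apply: adj_diag => t; rewrite mxE ler0n.
- move=> i j; rewrite mulmx_diag; case: eqP => [->|ij].
    by congr diag_mx; apply/rowP => t; rewrite !mxE -natrM mulnb andbb.
  rewrite -[RHS](@raddf0 _ _ (@diag_mx C K)); congr diag_mx; apply/rowP => t.
  rewrite !mxE -natrM mulnb; case: eqP => // ->.
  by case: eqP => // ij'; case: ij.
- rewrite -[RHS]diag_const_mx -raddf_sum; congr diag_mx; apply/rowP => t.
  rewrite summxE mxE (bigD1 (tag (enum_val t))) //= mxE eqxx big1 ?addr0 // => i it.
  by rewrite mxE eq_sym (negbTE it).
move=> i; rewrite -(ens_eta_omega rho_state).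
have -> : A *m D i *m adj A = \sum_(j < r i)
    (ens_eta rho i * lam i j) *: (psi i j *m adj (psi i j)).
  apply/matrixP => k l; rewrite [LHS]mxE [RHS]summxE.
  (* The index [i] becomes a one-term sum, so that the double sum can be reindexed over pairs. *)
  transitivity (\sum_(i' | i' == i) \sum_(j < r i')
      ens_eta rho i' * lam i' j * (psi i' j k 0 * (psi i' j l 0)^*)); last first.
    rewrite big_pred1_eq; apply: eq_bigr => j _; rewrite mxE; congr (_ * _).
    by rewrite mxE big_ord1 adjE.
  rewrite (sig_big_dep _ _ (fun i j =>
    ens_eta rho i * lam i j * (psi i j k 0 * (psi i j l 0)^*))).
  rewrite (reindex (@enum_val idx xpredT)) /=; last first.
    by apply: onW_bij; apply: enum_val_bij.
  rewrite [RHS]big_mkcond /=; apply: eq_bigr => t _.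
  rewrite mul_mx_diag adjE !mxE andbT.
  case: eqP => _; last by rewrite mulr0 mul0r.
  rewrite mulr1 rmorphM /= (conj_Creal (ger0_real (ltW (a0 _)))) -a2; ring.
have [eta_gt0|eta_le0] := boolP (0 < ens_eta rho i).
  by rewrite omegaE // scaler_sumr; apply: eq_bigr => j _; rewrite scalerA.
have -> : ens_eta rho i = 0.
  apply/eqP; move: eta_le0; rewrite lt_def ens_etaE //.
  by rewrite psd_trace_ge0 ?andbT ?negbK //; apply: weighted_psd.
by rewrite scale0r big1 // => j _; rewrite mul0r scale0r.
Qed.

Lemma score_isometry m (D : 'I_na -> 'M[C]_m) (V : 'M[C]_(m, N)) :
  \sum_i \tr (D i *m V *m X i *m adj V) =
  \sum_i \tr (adj V *m D i *m V *m X i).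
Proof. by apply: eq_bigr => i _; rewrite mxtrace_mulC !mulmxA. Qed.

(** Serves twice: with square [V] for von Neumann measurements, and with [V] into a larger space for
    POVMs. *)
Lemma score_isometry_max m (D : 'I_na -> 'M[C]_m) :
  (forall i, psd (D i)) -> (exists V : 'M[C]_(m, N), adj V *m V = 1%:M) ->
  exists2 V : 'M[C]_(m, N), adj V *m V = 1%:M &
    forall W : 'M[C]_(m, N), adj W *m W = 1%:M ->
      \sum_i \tr (adj W *m D i *m W *m X i) <=
      \sum_i \tr (adj V *m D i *m V *m X i).
Proof.
move=> pD /(isometry_max (D := D) (X := X)) [V|V V1 Vmax].
  apply: ger0_real; rewrite score_isometry; apply: sumr_ge0 => i _.
  by case: (psd_trace_mul (psd_conj V (pD i)) (weighted_psd rho_state i)).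
exists V => // W /Vmax.
by rewrite !score_isometry.
Qed.

(** Naimark dilation: the POVMs are exactly the [adj V *m D i *m V] with [V] an isometry into [na]
    copies of the space and [D i] the projection on copy [i]. So maximising over isometries
    suffices. *)
Lemma POVM_score_max : exists2 M : 'I_na -> 'M[C]_N, is_POVM M &
  forall M', is_POVM M' ->
    \sum_i \tr (M' i *m X i) <= \sum_i \tr (M i *m X i).
Proof.
pose E := @blockA C na N; pose D := @projA C na N.
have DE i : D i = adj (E i) *m E i by rewrite adj_blockA_mul.
have povm (V : 'M[C]_(na * N, N)) : adj V *m V = 1%:M ->
    is_POVM (fun i => adj V *m D i *m V).
  move=> V1; split=> [i|]; first exact/psd_conj/projA_psd.
  by rewrite -mulmx_suml -mulmx_sumr projA_sum mulmx1.
have [||V V1 Vmax] := @score_isometry_max _ D.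
- exact: projA_psd.
- pose i0 := Ordinal na_gt0; exists (adj (E i0)).
  by rewrite adjK blockA_mul_adj eqxx.
exists (fun i => adj V *m D i *m V); first exact: povm.
move=> M [pM sumM]; pose S i := sqrtm (M i).
have hS i : adj (S i) = S i by have [[]] := sqrtm_spec (pM i).
have SS i : S i *m S i = M i by have [] := sqrtm_spec (pM i).
(* The dilating isometry stacks the square roots of the POVM elements. *)
pose W := \sum_i adj (E i) *m S i.
have EW i : E i *m W = S i.
  rewrite mulmx_sumr (bigD1 i) //= big1 => [|j ji]; rewrite mulmxA blockA_mul_adj.
    by rewrite eqxx mul1mx addr0.
  by rewrite eq_sym (negbTE ji) mul0mx.
have WM i : adj W *m D i *m W = M i.
  transitivity (adj (E i *m W) *m (E i *m W)); last by rewrite EW hS SS.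
  by rewrite DE adjM !mulmxA.
have W1 : adj W *m W = 1%:M.
  rewrite -sumM -{2}[W]projA_sumK mulmx_sumr; apply: eq_bigr => i _.
  by rewrite mulmxA WM.
have := Vmax W W1; under eq_bigr do rewrite WM.
by [].
Qed.

End Optimizers.

(* c is C_F^a(rho) (the minimum of 1 - F^2 over partial incoherent states),
   1 - c is P_S^{opt(vN)}, i.e. c = P_E^{opt(vN)};  d is P_S^{opt} (over POVMs),
   so P_E^{opt} = 1 - d. *)
Theorem theorem3 (C : numClosedFieldType) (na nb : nat)
    (rho : 'M[C]_(na * nb)) :
  is_state rho ->
  exists c d : C,
    is_min (CF_values rho) c /\
    is_max (vN_success (ens_eta rho) (ens_omega rho)) (1 - c) /\
    is_max (POVM_success (ens_eta rho) (ens_omega rho)) d /\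
    1 - d <= c /\
    (lin_indep_states (ens_eta rho) (ens_omega rho) -> c = 1 - d).
Proof.
move=> rho_state.
pose f (P : 'I_na -> 'M[C]_(na * nb)) := \sum_i \tr (P i *m weighted rho i).
have fE P : success (ens_eta rho) (ens_omega rho) P = f P by apply: ens_successE.
have [||U U1 Umax] := 
  @score_isometry_max C na nb rho rho_state _ (@projA C na nb).
- exact: projA_psd.
- by exists 1%:M; rewrite adj_id mulmx1.
pose P0 i := adj U *m projA i *m U; have vN0 : is_vN P0 by apply: vN_conj_projA.
have fid_le sigma : partial_incoherent sigma -> fidelity rho sigma ^+ 2 <= f P0.
  move=> /(fidelity_le_rotated_projections rho_state) [W /Umax WU fW].
  apply: le_trans fW _; apply: le_trans WU.
  by rewrite score_isometry.
(* [Umax] compares only unitary rotations of the block projections; the detour through the fidelity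
   extends the bound to projectors of arbitrary ranks. *)
have vN_le P : is_vN P -> f P <= f P0.
  move=> /(vN_success_le_fidelity rho_state) [sigma incoh h].
  exact: le_trans h (fid_le _ incoh).
have [M POVM_M Mmax] := POVM_score_max rho_state.
have le_d : f P0 <= f M by apply: Mmax; apply: vN_POVM.
exists (1 - f P0), (f M); split; first split.
(* The state built from [P0] has squared fidelity at least [f P0], which is also an upper bound; so
   the minimum is attained. *)
- have [sigma incoh h] := vN_success_le_fidelity rho_state vN0.
  exists sigma; split=> //; congr (_ - _); apply/le_anti.
  by rewrite h fid_le.
- by move=> x [sigma [incoh ->]]; rewrite lerD2l lerN2 fid_le.
split; first split.
- by exists P0; rewrite fE opprB addrC subrK.
- by move=> x [P [vN ->]]; rewrite fE opprB addrC subrK vN_le.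
split; first split.
- by exists M; rewrite fE.
- by move=> x [M' [POVM_M' ->]]; rewrite fE Mmax.
split; first by rewrite lerD2l lerN2.
move=> /(lin_indep_factorization rho_state) [r [A [L [D [LA hD DD sumD XE]]]]].
congr (_ - _); apply/le_anti; rewrite le_d /=.
have [P vN PM] := optimal_POVM_projective (weighted_psd rho_state)
  LA hD DD sumD XE (na_gt0 rho_state) POVM_M Mmax.
by rewrite {1}/f -PM vN_le.
Qed.
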